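(* For every real number $\zeta>\frac{41}{2}$ there exists a positive integer $c=c(\zeta)$ such that there is an $O(n^2)$-time algorithm which, given a bipartite graph $G$ on $n=|V(G)|$ vertices with $\Delta:=\Delta(G)\ge c$ and $n\ge \zeta\Delta$, constructs an equitable $\left(\left\lceil \Delta/2\right\rceil+1\right)$-coloring of $G$.
   Context: Graphs have finite vertex sets, no loops, and no parallel edges. $\Delta(G)$ denotes the maximum degree of $G$. A proper $k$-coloring of $G$ (an assignment of colors from a set of $k$ colors to the vertices in which adjacent vertices get distinct colors) is equitable if the sizes of any two of its $k$ color classes differ by at most one. Arithmetic operations on integers are counted as taking constant time. *)

(* Defs.v *)
From HB Require Import structures.
From mathcomp Require Import all_boot all_order all_algebra.
From mathcomp Require Import reals.

Set Implicit Arguments.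
Unset Strict Implicit.
Unset Printing Implicit Defensive.

Import Order.TTheory GRing.Theory Num.Theory.

(** * Graphs *)

Record sgraph (T : finType) := SGraph {
  edge :> rel T;
  edge_sym : symmetric edge;
  edge_irr : irreflexive edge
}.

Definition max_degree (T : finType) (G : sgraph T) : nat :=
  \max_(x : T) #|[set y | G x y]|.

Definition bipartite (T : finType) (G : sgraph T) : Prop :=
  exists A : {set T}, forall x y, G x y -> (x \in A) != (y \in A).

Definition proper_coloring (T : finType) (G : sgraph T) k (f : T -> 'I_k) :
  Prop := forall x y, G x y -> f x != f y.

(* The classes of all [k] available colours are compared, empty ones included. *)
Definition equitable_coloring (T : finType) (G : sgraph T) k (f : T -> 'I_k) :
  Prop :=
  proper_coloring G f /\
  forall a b : 'I_k, #|[set x | f x == a]| <= #|[set x | f x == b]| + 1.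

(** * Algorithms

  A random access machine, programmed by structured commands.  The memory is
  an array of integers indexed by integers; addresses can be computed
  (indirect addressing).  A program is a fixed finite piece of syntax, so it
  cannot depend on the input. *)

Definition memory := int -> int.

Definition update (s : memory) (a v : int) : memory :=
  fun b => if b == a then v else s b.

Inductive binop := Add | Sub | Mul | Div | Mod | Eq | Le.

Inductive expr :=
  | Lit of int
  | Get of expr (* the content of the cell at the given address *)
  | Bin of binop & expr & expr.

Inductive cmd :=
  | Skip
  | Set_ of expr & expr (* [Set_ a e] writes [e] in the cell at address [a] *)
  | Seq of cmd & cmd
  | If of expr & cmd & cmd
  | While of expr & cmd.

(* [Div] and [Mod] are Euclidean, with the conventions of [intdiv] for a zero
   divisor; tests return 0 or 1. *)
Definition eval_binop (o : binop) (x y : int) : int :=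
  match o with
  | Add => (x + y)%R
  | Sub => (x - y)%R
  | Mul => (x * y)%R
  | Div => (x %/ y)%Z
  | Mod => (x %% y)%Z
  | Eq => Posz (x == y)
  | Le => Posz (x <= y)%R
  end.

Fixpoint eval (s : memory) (e : expr) : int :=
  match e with
  | Lit z => z
  | Get a => s (eval s a)
  | Bin o e1 e2 => eval_binop o (eval s e1) (eval s e2)
  end.

(* Unit cost for each constant, memory access and arithmetic operation. *)
Fixpoint cost (e : expr) : nat :=
  match e with
  | Lit _ => 1
  | Get a => (cost a).+1
  | Bin _ e1 e2 => (cost e1 + cost e2).+1
  end.

(* [exec w c s t s']: started in memory [s], the command [c] halts after
   exactly [t] elementary steps in memory [s'], and all integers that it writes
   have absolute value at most [w].  A run that exceeds [w] is stuck.

   The bound [w] is there because unit-cost multiplication and division of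
   integers of unrestricted length would make the machine unrealistically
   strong; below it is polynomial in the size of the graph.  Values computed
   inside an expression need no separate bound: expressions have a fixed size,
   so their values are polynomially bounded when the memory contents are. *)
Inductive exec (w : nat) : cmd -> memory -> nat -> memory -> Prop :=
  | ExecSkip s : exec w Skip s 1 s
  | ExecSet a e s :
      (`|eval s e| <= w)%N ->
      exec w (Set_ a e) s (cost a + cost e).+1 (update s (eval s a) (eval s e))
  | ExecSeq c1 c2 s1 t1 s2 t2 s3 :
      exec w c1 s1 t1 s2 -> exec w c2 s2 t2 s3 ->
      exec w (Seq c1 c2) s1 (t1 + t2) s3
  | ExecIfTrue e c1 c2 s t s' :
      eval s e <> 0%R -> exec w c1 s t s' ->
      exec w (If e c1 c2) s (cost e + t).+1 s'
  | ExecIfFalse e c1 c2 s t s' :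
      eval s e = 0%R -> exec w c2 s t s' ->
      exec w (If e c1 c2) s (cost e + t).+1 s'
  | ExecWhileFalse e c s :
      eval s e = 0%R -> exec w (While e c) s (cost e).+1 s
  | ExecWhileTrue e c s1 t1 s2 t2 s3 :
      eval s1 e <> 0%R -> exec w c s1 t1 s2 -> exec w (While e c) s2 t2 s3 ->
      exec w (While e c) s1 (cost e + t1 + t2).+1 s3.

(* Input format: [n] in cell 0, then the adjacency matrix row by row, the entry
   [(i, j)] being in cell [1 + i * n + j]; all other cells contain 0. *)
Definition graph_input n (G : sgraph 'I_n) : memory := fun a =>
  match a with
  | Posz 0 => Posz n
  | Posz m.+1 =>
      Posz [exists i : 'I_n, exists j : 'I_n, (m == i * n + j) && G i j]
  | Negz _ => 0%R
  end.

(* Output format: the colour of vertex [i] in cell [1 + i]. *)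
Definition coloring_output n k (s : memory) (f : 'I_n -> 'I_k) : Prop :=
  forall i : 'I_n, s (Posz i.+1) = Posz (f i).

(* Main.v *)
Require Import Defs.
From HB Require Import structures.
From mathcomp Require Import all_boot all_order all_algebra.
From mathcomp Require Import reals.
From mathcomp Require Import zify.

Set Implicit Arguments.
Unset Strict Implicit.
Unset Printing Implicit Defensive.

Import Order.TTheory GRing.Theory Num.Theory.

(** Let [A] be the smaller side of a 2-colouring of the graph, [B] the other
  side, [a = |A|], [k] the number of colours and [s = n %/ k >= 40].  If [A]
  could be cut into classes of sizes [s] and [s + 1] with nothing left, it
  would suffice to cut [B] into the remaining ones.  In general [r <= s]
  vertices of [A] are left over.  They are spread over 8 mixed classes, so that
  each of these contains at most [r / 8 + 1] vertices of [A], which have at most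
  [(s / 8 + 1) * Delta] neighbours.  Since [|B| >= n / 2] is about
  [s * Delta / 4], each mixed class can be completed greedily by nonadjacent
  vertices of [B], and the rest of [B] is cut into classes of sizes [s] and
  [s + 1].

  The algorithm is a program of a language with natural numbers and bounded
  loops only, compiled to the machine.  There every assignment increases the
  largest stored integer by at most its own weight, so that the syntactic bound
  [tm] on the running time also bounds the growth of the integers. *)

(** * A language of bounded loops *)

Inductive arr := Inp | Var | St | Cl.

Definition arr_eqb (a b : arr) : bool :=
  match a, b with
  | Inp, Inp | Var, Var | St, St | Cl, Cl => true
  | _, _ => false
  end.

Definition state := arr -> nat -> nat.

Definition upd (S : state) (a : arr) (i v : nat) : state :=
  fun b j => if arr_eqb b a && (j == i) then v else S b j.

Inductive nexpr :=
  | NLit of nat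
  | NGet of arr & nexpr
  | NBin of binop & nexpr & nexpr.

Inductive ncmd :=
  | NSkip
  | NSet of arr & nexpr & nexpr
  | NSeq of ncmd & ncmd
  | NIf of nexpr & ncmd & ncmd
  | NFor of nat & ncmd.

Definition nop (o : binop) (x y : nat) : nat :=
  match o with
  | Add => x + y
  | Defs.Sub => x - y
  | Mul => x * y
  | Div => x %/ y
  | Mod => x %% y
  | Eq => x == y
  | Le => x <= y
  end.

Fixpoint nev (S : state) (e : nexpr) : nat :=
  match e with
  | NLit z => z
  | NGet a e => S a (nev S e)
  | NBin o e1 e2 => nop o (nev S e1) (nev S e2)
  end.

(** Every loop counts from 0 up to the content of input cell 0, which is the number of vertices. Its
    counter finally holds that number, because this is the value that leaves the compiled
    [While]. *)
Fixpoint run (c : ncmd) (S : state) : state :=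
  match c with
  | NSkip => S
  | NSet a e1 e2 => upd S a (nev S e1) (nev S e2)
  | NSeq c1 c2 => run c2 (run c1 S)
  | NIf e c1 c2 => if nev S e != 0 then run c1 S else run c2 S
  | NFor x c =>
      upd (iteri (S Inp 0) (fun i S' => run c (upd S' Var x i)) S)
          Var x (S Inp 0)
  end.

(* The input array occupies the nonnegative cells, the three others are
   interleaved in the negative ones. *)
Definition addr (a : arr) (i : nat) : int :=
  match a with
  | Inp => Posz i
  | Var => Negz (3 * i)
  | St => Negz (3 * i + 1)
  | Cl => Negz (3 * i + 2)
  end.

Definition caddr (a : arr) (e : expr) : expr :=
  match a with
  | Inp => e
  | Var => Bin Defs.Sub (Lit (Negz 0)) (Bin Mul (Lit (Posz 3)) e)
  | St => Bin Defs.Sub (Lit (Negz 1)) (Bin Mul (Lit (Posz 3)) e)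
  | Cl => Bin Defs.Sub (Lit (Negz 2)) (Bin Mul (Lit (Posz 3)) e)
  end.

(* Truncated subtraction is [(y <= x) * (x - y)]. *)
Fixpoint cexpr (e : nexpr) : expr :=
  match e with
  | NLit z => Lit (Posz z)
  | NGet a e => Get (caddr a (cexpr e))
  | NBin Defs.Sub e1 e2 =>
      Bin Mul (Bin Le (cexpr e2) (cexpr e1))
        (Bin Defs.Sub (cexpr e1) (cexpr e2))
  | NBin o e1 e2 => Bin o (cexpr e1) (cexpr e2)
  end.

Definition next (x : nat) : nexpr :=
  NBin Add (NLit 1) (NGet Var (NLit x)).

Definition loop_test (x : nat) : nexpr :=
  NBin Le (next x) (NGet Inp (NLit 0)).

Definition set_var (x : nat) (e : nexpr) : cmd :=
  Set_ (caddr Var (Lit (Posz x))) (cexpr e).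

Definition loop (x : nat) (c : cmd) : cmd :=
  While (cexpr (loop_test x)) (Seq c (set_var x (next x))).

Fixpoint comp (c : ncmd) : cmd :=
  match c with
  | NSkip => Skip
  | NSet a e1 e2 => Set_ (caddr a (cexpr e1)) (cexpr e2)
  | NSeq c1 c2 => Seq (comp c1) (comp c2)
  | NIf e c1 c2 => If (cexpr e) (comp c1) (comp c2)
  | NFor x c => Seq (set_var x (NLit 0)) (loop x (comp c))
  end.

(* Literals are counted with their value, so that [wt] bounds the increase of
   the largest integer in memory as well as the running time. *)
Fixpoint wt (e : nexpr) : nat :=
  match e with
  | NLit z => z + 1
  | NGet _ e => wt e + 5
  | NBin _ e1 e2 => 2 * (wt e1 + wt e2) + 3
  end.

Fixpoint tm (N : nat) (c : ncmd) : nat :=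
  match c with
  | NSkip => 1
  | NSet _ e1 e2 => wt e1 + wt e2 + 5
  | NSeq c1 c2 => tm N c1 + tm N c2
  | NIf e c1 c2 => wt e + tm N c1 + tm N c2 + 1
  | NFor _ c => N * (tm N c + 40) + 40
  end.

Fixpoint depth (c : ncmd) : nat :=
  match c with
  | NSkip | NSet _ _ _ => 0
  | NSeq c1 c2 | NIf _ c1 c2 => maxn (depth c1) (depth c2)
  | NFor _ c => (depth c).+1
  end.

(** Expressions whose value exceeds the largest stored integer by at most their weight: no product
    or sum of two stored values may be assigned. Inside addresses and tests all operations remain
    allowed. *)
Fixpoint lin (e : nexpr) : bool :=
  match e with
  | NLit _ | NGet _ _ | NBin Eq _ _ | NBin Le _ _ => true
  | NBin Add (NLit _) e => lin e
  | NBin Defs.Sub e _ | NBin Div e _ | NBin Mod e _ => lin e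
  | _ => false
  end.

(* A write into a nonconstant cell of an array counts as a write into all its
   cells, except that input cell 0 is not written by addresses [1 + e]. *)
Fixpoint writes (c : ncmd) (a : arr) (i : nat) : bool :=
  match c with
  | NSkip => false
  | NSet b e _ =>
      arr_eqb a b && match b, e with
                     | Var, NLit y => i == y
                     | Inp, NBin Add (NLit 1) _ => i != 0
                     | _, _ => true
                     end
  | NSeq c1 c2 | NIf _ c1 c2 => writes c1 a i || writes c2 a i
  | NFor x c => arr_eqb a Var && (i == x) || writes c a i
  end.

Fixpoint wf (c : ncmd) : bool :=
  match c with
  | NSkip => true
  | NSet _ _ e => lin e
  | NSeq c1 c2 | NIf _ c1 c2 => wf c1 && wf c2
  | NFor x c => [&& ~~ writes c Var x, ~~ writes c Inp 0 & wf c]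
  end.

(** * Correctness, running time and word size of compiled programs *)

Definition rep (s : memory) (S : state) : Prop :=
  forall a i, s (addr a i) = Posz (S a i).

Lemma eval_caddr s a e i : eval s e = Posz i -> eval s (caddr a e) = addr a i.
Proof. by case: a => //= ->; rewrite !NegzE; lia. Qed.

Lemma eval_cexpr s S e : rep s S -> eval s (cexpr e) = Posz (nev S e).
Proof.
move=> sS; elim: e => [//|a e IH|o e1 IH1 e2 IH2].
  by rewrite /= (eval_caddr _ IH) sS.
case: o; rewrite /= IH1 IH2 ?divz_nat ?modz_nat //.
by case: (leqP (nev S e2) (nev S e1)) => h /=; lia.
Qed.

Lemma cost_cexpr e : cost (cexpr e) <= wt e.
Proof.
elim: e => [z|a e IH|o e1 IH1 e2 IH2] /=; first lia.
  by case: a => /=; lia.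
by case: o => /=; lia.
Qed.

Lemma cost_caddr a e : cost (caddr a e) <= cost e + 4.
Proof. by case: a => /=; lia. Qed.

Lemma nev_lin S B e : (forall a i, S a i <= B) -> lin e -> nev S e <= B + wt e.
Proof.
move=> SB; elim: e => [z _|a e _ _|o e1 IH1 e2 IH2] /=; first by lia.
  by rewrite (leq_trans (SB _ _)) ?leq_addr.
case: o => /=.
- by case: e1 {IH1} => // z /IH2 /=; lia.
- by move=> /IH1; lia.
- by [].
- by move=> /IH1 h; have := leq_div (nev S e1) (nev S e2); lia.
- by move=> /IH1 h; have := leq_mod (nev S e1) (nev S e2); lia.
- by move=> _; case: eqP => _ /=; lia.
- by move=> _; case: (nev S e1 <= nev S e2) => /=; lia.
Qed.

Lemma addr_inj a b i j : (addr a i == addr b j) = arr_eqb a b && (i == j).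
Proof. by case: a; case: b => /=; rewrite ?NegzE; lia. Qed.

Lemma rep_update s S a i v :
  rep s S -> rep (update s (addr a i) (Posz v)) (upd S a i v).
Proof. by move=> sS b j; rewrite /update /upd addr_inj; case: ifP. Qed.

Definition frame (c : ncmd) (S S' : state) : Prop :=
  forall a i, ~~ writes c a i -> S' a i = S a i.

Lemma run_frame c S : frame c S (run c S).
Proof.
elim: c S => [|b e1 e2|c1 IH1 c2 IH2|e c1 IH1 c2 IH2|x c IH] S a i //=.
- rewrite /upd; case: arr_eqb => //=; case: b => //; case: e1 => //=.
  + by case=> // -[] //= [|[|]] //= e; rewrite negbK => /eqP->.
  + by move=> y /negPf->.
- by case/norP=> h1 h2; rewrite IH2 // IH1.
- by case/norP=> h1 h2; case: ifP; rewrite (IH1, IH2).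
- case/norP=> /negPf ax h; rewrite /upd ax.
  by elim: (S Inp 0) => //= m IHm; rewrite IH // /upd ax.
Qed.

(** Induction on [c]. The quantity [tm N c] bounds both the time and the growth of the stored
    integers, so bounds along a sequence simply add up and [B + tm N c <= w] keeps the run from
    getting stuck. *)
Lemma exec_comp c N w B s S :
    wf c -> ~~ writes c Inp 0 -> rep s S -> S Inp 0 = N ->
    N <= B -> (forall a i, S a i <= B) -> B + tm N c <= w ->
  exists t s', [/\ exec w (comp c) s t s', t <= tm N c, rep s' (run c S)
                 & forall a i, run c S a i <= B + tm N c].
Proof.
elim: c B s S => [|a e1 e2|c1 IH1 c2 IH2|e c1 IH1 c2 IH2|x c IH] B s S /=.
- move=> _ _ sS SN NB SB Bw; exists 1, s; split=> //; first exact: ExecSkip.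
  by move=> a i; rewrite (leq_trans (SB a i)) ?leq_addr.
- move=> le2 _ sS SN NB SB Bw.
  have v2 := nev_lin SB le2.
  exists (cost (caddr a (cexpr e1)) + cost (cexpr e2)).+1.
  exists (update s (addr a (nev S e1)) (Posz (nev S e2))); split.
  + rewrite -(eval_caddr a (eval_cexpr e1 sS)) -(eval_cexpr e2 sS).
    by apply: ExecSet; rewrite (eval_cexpr e2 sS) absz_nat; lia.
  + have := cost_cexpr e1; have := cost_cexpr e2.
    by have := cost_caddr a (cexpr e1); lia.
  + exact: rep_update.
  + by move=> b i; rewrite /upd; case: ifP => _; [lia|have := SB b i; lia].
- case/andP=> w1 w2 /norP[k1 k2] sS SN NB SB Bw.
  have [|t1 [s1 [x1 l1 r1 b1]]] := IH1 B s S w1 k1 sS SN NB SB; first by lia.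
  have [|||t2 [s2 [x2 l2 r2 b2]]] :=
    IH2 (B + tm N c1) s1 (run c1 S) w2 k2 r1 _ _ b1.
  + by rewrite run_frame.
  + by lia.
  + by lia.
  exists (t1 + t2), s2; split=> //.
  + exact: ExecSeq x1 x2.
  + by lia.
  + by move=> a i; have := b2 a i; lia.
- case/andP=> w1 w2 /norP[k1 k2] sS SN NB SB Bw; have ce := cost_cexpr e.
  case: ifPn => [nz|/negPn/eqP z].
  + have [|t1 [s1 [x1 l1 r1 b1]]] := IH1 B s S w1 k1 sS SN NB SB; first by lia.
    exists (cost (cexpr e) + t1).+1, s1; split=> //.
    * by apply: ExecIfTrue => //; rewrite (eval_cexpr e sS); lia.
    * by lia.
    * by move=> a i; have := b1 a i; lia.
  + have [|t1 [s1 [x1 l1 r1 b1]]] := IH2 B s S w2 k2 sS SN NB SB; first by lia.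
    exists (cost (cexpr e) + t1).+1, s1; split=> //.
    * by apply: ExecIfFalse => //; rewrite (eval_cexpr e sS) z.
    * by lia.
    * by move=> a i; have := b1 a i; lia.
case/and3P=> kx k0 wc _ sS SN NB SB Bw.
pose F i S' := run c (upd S' Var x i).
pose T i := iteri i F S.
have T0 i : T i Inp 0 = N by elim: i => //= i IHi; rewrite /F run_frame.
(* Induction on the number [m] of remaining iterations. The 40 pays for the loop test and the
   increment of the counter, the 20 for the last, failing test. *)
have exec_loop m i s1 : i + m = N -> rep s1 (upd (T i) Var x i) ->
    (forall a j, upd (T i) Var x i a j <= B + i * (tm N c + 40)) ->
    exists t s', [/\ exec w (loop x (comp c)) s1 t s',
       t <= m * (tm N c + 40) + 20, rep s' (upd (T N) Var x N)
     & forall a j, upd (T N) Var x N a j <= B + N * (tm N c + 40)].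
  elim: m i s1 => [|m IHm] i s1 im r1 b1.
    have iN : i = N by lia.
    subst i; exists (cost (cexpr (loop_test x))).+1, s1; split=> //.
    apply: ExecWhileFalse; rewrite (eval_cexpr _ r1) /= {2}/upd /= T0.
    by rewrite /upd /= eqxx; lia.
  have [|||t2 [s2 [x2 l2 r2 b2]]] := IH _ s1 _ wc k0 r1 _ _ b1.
  + by rewrite /upd /= T0.
  + by lia.
  + have : i.+1 * (tm N c + 40) <= N * (tm N c + 40) by rewrite leq_mul2r; lia.
    by lia.
  have i2 : run c (upd (T i) Var x i) Var x = i.
    by rewrite run_frame // /upd /= eqxx.
  have [| |t3 [s3 [x3 l3 r3 b3]]] :=
    IHm i.+1 (update s2 (addr Var x) (Posz i.+1)) _ (rep_update _ _ _ r2).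
  + by lia.
  + move=> a j; rewrite mulSn /upd; case: ifP => _.
      have : i <= i * (tm N c + 40) by rewrite leq_pmulr // addn_gt0 orbT.
      by lia.
    by have := b2 a j; rewrite /= -/(T i) /F /upd; lia.
  exists ((cost (cexpr (loop_test x))
    + (t2 + (cost (caddr Var (Lit (Posz x))) + cost (cexpr (next x))).+1)
    + t3).+1), s3.
  split=> //.
  + apply: ExecWhileTrue x3.
      by rewrite (eval_cexpr _ r1) /= {2}/upd /= T0 /upd /= eqxx; lia.
    apply: ExecSeq x2 _.
    have -> : Posz i.+1 = eval s2 (cexpr (next x)).
      by rewrite (eval_cexpr _ r2) /= i2; lia.
    rewrite -(@eval_caddr s2 Var (Lit (Posz x)) x) //.
    by apply: ExecSet; rewrite (eval_cexpr _ r2) absz_nat /= i2; lia.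
  + by rewrite mulSn /=; lia.
have [|||t2 [s2 [x2 l2 r2 b2]]] :=
  exec_loop N 0 (update s (addr Var x) (Posz 0)).
- by [].
- exact: rep_update.
- by move=> a i; rewrite /upd; case: ifP; rewrite ?mul0n ?addn0.
exists ((cost (caddr Var (Lit (Posz x))) + 1).+1 + t2), s2; split.
- apply: ExecSeq x2; rewrite -(@eval_caddr s Var (Lit (Posz x)) x) //.
  exact: (@ExecSet w (caddr Var (Lit (Posz x))) (Lit (Posz 0))).
- by rewrite /=; lia.
- by rewrite SN.
- by rewrite SN => a i; apply: leq_trans (b2 a i) _; lia.
Qed.

(** Each nested loop contributes one factor [N], so the time is a polynomial in [N] whose degree is
    the nesting depth. *)
Lemma tm_depth N c : 0 < N -> tm N c <= tm 1 c * N ^ depth c.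
Proof.
move=> N0; have p d d' : d <= d' -> N ^ d <= N ^ d' by apply: leq_pexp2l.
elim: c => [|a e1 e2|c1 IH1 c2 IH2|e c1 IH1 c2 IH2|x c IH] /=.
- by [].
- by rewrite muln1.
- rewrite mulnDl leq_add //.
    by rewrite (leq_trans IH1) // leq_mul2l p ?orbT ?leq_maxl.
  by rewrite (leq_trans IH2) // leq_mul2l p ?orbT ?leq_maxr.
- rewrite !mulnDl; rewrite !leq_add //.
  + by rewrite leq_pmulr ?expn_gt0 ?N0.
  + by rewrite (leq_trans IH1) // leq_mul2l p ?orbT ?leq_maxl.
  + by rewrite (leq_trans IH2) // leq_mul2l p ?orbT ?leq_maxr.
  + by rewrite mul1n expn_gt0 N0.
- have X0 : 0 < N ^ depth c by rewrite expn_gt0 N0.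
  have h1 := leq_mul (leqnn N) IH.
  have h2 : N <= N * N ^ depth c by rewrite leq_pmulr.
  by rewrite mul1n expnS !mulnDl mulnCA mulnDr; lia.
Qed.


(** All initial cells are at most [N], and [N + tm N c] is absorbed by raising the coefficient by
    one; the same quantity then serves as time bound and as word bound. *)
Lemma exec_comp_depth c d N s S :
    wf c -> ~~ writes c Inp 0 -> depth c = d.+1 -> 0 < N -> rep s S ->
    S Inp 0 = N -> (forall a i, S a i <= N) ->
  exists t s', [/\ exec ((tm 1 c + 1) * N ^ d.+1) (comp c) s t s',
    t <= (tm 1 c + 1) * N ^ d.+1 & rep s' (run c S)].
Proof.
move=> wc kc cd N0 sS SN SB; have tmN := tm_depth c N0; rewrite cd in tmN.
have NN : N <= N ^ d.+1 by rewrite -[leqLHS]expn1 leq_pexp2l.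
have [|t [s' [ex tle rs _]]] :=
  @exec_comp c N ((tm 1 c + 1) * N ^ d.+1) N s S wc kc sS SN (leqnn N) SB.
  by rewrite mulnDl; lia.
by exists t, s'; split=> //; rewrite mulnDl; lia.
Qed.

(** * The program *)

Lemma runSkip S : run NSkip S = S. Proof. by []. Qed.

Lemma runSet a e1 e2 S :
  run (NSet a e1 e2) S = upd S a (nev S e1) (nev S e2).
Proof. by []. Qed.

Lemma runSeq c1 c2 S : run (NSeq c1 c2) S = run c2 (run c1 S).
Proof. by []. Qed.

Lemma runIf e c1 c2 S :
  run (NIf e c1 c2) S = if nev S e != 0 then run c1 S else run c2 S.
Proof. by []. Qed.

Definition runE := (runSkip, runSet, runSeq, runIf).

(** Invariant rule for loops. The body may assume that the counter is [i] and that whatever the loop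
    does not write still has its initial value. Since the loop itself writes the counter, [P] must
    be insensitive to it. *)
Lemma for_ind n x c S (P : nat -> state -> Prop) :
    S Inp 0 = n -> ~~ writes c Var x ->
    (forall i S' v, P i S' -> P i (upd S' Var x v)) ->
    P 0 S ->
    (forall i S', i < n -> S' Var x = i -> frame (NFor x c) S S' ->
       P i S' -> P i.+1 (run c S')) ->
  P n (run (NFor x c) S).
Proof.
move=> <- kx Pupd P0 PS; apply: (Pupd).
have : forall m, m <= S Inp 0 ->
    let S' := iteri m (fun i S' => run c (upd S' Var x i)) S in
    frame (NFor x c) S S' /\ P m S'; last by move=> /(_ _ (leqnn _)) [].
elim=> [|m IHm] mn; first by split.
have [fr Pm] := IHm (ltnW mn); have fu v S' : frame (NFor x c) S S' ->
    frame (NFor x c) S (upd S' Var x v).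
  by move=> h a i w; rewrite /upd; move: (w) => /norP[/negPf-> _]; apply: h.
split=> [a i w|]; last first.
  by apply: PS => //; [rewrite /upd /= eqxx|apply: fu|apply: Pupd].
rewrite /= run_frame; first exact: fu.
by move: w => /norP[].
Qed.

#[global] Arguments run : simpl never.

(** * Counting in initial segments of the natural numbers *)

(** Besides the size of a class, this gives ranks: [num P v] is the position of [v] among the
    elements of [P], counted from 0. *)
Definition num (P : pred nat) (n : nat) : nat := count P (iota 0 n).

Lemma numS P n : num P n.+1 = num P n + P n.
Proof. by rewrite /num -addn1 iotaD count_cat /= addn0. Qed.

Lemma eq_num (P Q : pred nat) n :
  (forall i, i < n -> P i = Q i) -> num P n = num Q n.
Proof. by move=> e; apply: eq_in_count => i; rewrite mem_iota => /e. Qed.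

Lemma leq_num (P Q : pred nat) n :
  (forall i, i < n -> P i -> Q i) -> num P n <= num Q n.
Proof.
elim: n => // n IH h; rewrite !numS leq_add ?IH // => [i /ltnW|].
  exact: h.
by case: (boolP (P n)) => // /h ->.
Qed.

Lemma num0 (P : pred nat) n : (forall v, v < n -> ~~ P v) -> num P n = 0.
Proof.
move=> h; rewrite /num (eq_in_count (a2 := pred0)) ?count_pred0 // => v.
by rewrite mem_iota => /h/negPf.
Qed.

Lemma num_ltn P n : num P n < n -> exists2 i, i < n & ~~ P i.
Proof.
elim: n => // n IH; rewrite numS.
case: (boolP (P n)) => [_|Pn _]; last by exists n.
by rewrite addn1 ltnS => /IH [i /ltnW h ?]; exists i.
Qed.

Lemma num_full P n : num P n = n -> forall i, i < n -> P i.
Proof.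
elim: n => // n IH; rewrite numS => h i.
have le : num P n <= n by rewrite -[leqRHS](size_iota 0) count_size.
rewrite ltnS leq_eqVlt; case: (boolP (P n)) h => Pn h; last by lia.
by case/predU1P=> [->//|]; apply: IH; lia.
Qed.

Lemma num_upd1 (P Q : pred nat) n p : p < n -> ~~ P p -> Q p ->
  (forall i, i < n -> i != p -> Q i = P i) -> num Q n = (num P n).+1.
Proof.
elim: n => // n IH; rewrite ltnS leq_eqVlt => /predU1P[->|pn] Pp Qp e.
  rewrite !numS (negPf Pp) Qp addn0 addn1; congr _.+1.
  by apply: eq_num => i lin; rewrite e ?ltnS 1?ltnW // ltn_eqF.
rewrite !numS e ?IH //; first by move=> i /ltnW; apply: e.
by rewrite gtn_eqF.
Qed.

(* Text of the colouring program *)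
Declare Scope prog_scope.
Delimit Scope prog_scope with prog.
Bind Scope prog_scope with nexpr.
Bind Scope prog_scope with ncmd.
Coercion NLit : nat >-> nexpr.
Notation "a + b" := (NBin Add a b) : prog_scope.
Notation "a - b" := (NBin Defs.Sub a b) : prog_scope.
Notation "a * b" := (NBin Mul a b) : prog_scope.
Notation "a %/ b" := (NBin Div a b) : prog_scope.
Notation "a %% b" := (NBin Mod a b) : prog_scope.
Notation "a == b" := (NBin Eq a b) : prog_scope.
Notation "a <= b" := (NBin Le a b) : prog_scope.
Notation "$ x" := (NGet Var (NLit x)) (at level 5, format "$ x") : prog_scope.
Notation "x ::= e" := (NSet Var (NLit x) e) (at level 80) : prog_scope.
Notation "c1 ;; c2" := (NSeq c1 c2)
  (at level 90, right associativity) : prog_scope.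
Notation "'IF' e 'THEN' c" := (NIf e c NSkip)
  (at level 85, c at level 85) : prog_scope.
Notation "'FOR' x 'DO' c" := (NFor x c)
  (at level 85, c at level 85) : prog_scope.

Notation vi := 0 (only parsing).
Notation vv := 1 (only parsing).
Notation vu := 2 (only parsing).
Notation vDelta := 3 (only parsing).
Notation vcnt := 4 (only parsing).
Notation vk := 5 (only parsing).
Notation vsel := 6 (only parsing).
Notation va := 7 (only parsing).
Notation vsm := 8 (only parsing).
Notation vs := 9 (only parsing).
Notation vt := 10 (only parsing).
Notation vM := 11 (only parsing).
Notation vj := 12 (only parsing).
Notation vr := 13 (only parsing).
Notation vl := 14 (only parsing).
Notation vidx := 15 (only parsing).
Notation vok := 16 (only parsing).

Section Programs.
Local Open Scope prog_scope.

Definition cadj (e1 e2 : nexpr) : nexpr :=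
  NGet Inp (1 + (e1 * NGet Inp 0 + e2)).

Definition pdegree : ncmd :=
  FOR vv DO IF cadj $vu $vv THEN vcnt ::= 1 + $vcnt.

Definition pmaxdegree : ncmd :=
  FOR vu DO (vcnt ::= 0;; pdegree;; IF $vDelta <= $vcnt THEN vDelta ::= $vcnt).

Definition pdeg : ncmd :=
  vDelta ::= 0;; pmaxdegree;; vk ::= 1 + (1 + $vDelta) %/ 2.

(* In the array [St], 0 stands for an uncoloured vertex, 1 and 2 for the two
   colours, and 3 and 4 for these colours at vertices whose neighbours have all
   been coloured.  Each round processes one vertex, a coloured one if possible;
   this replaces the queue of a breadth-first search. *)
Definition ppick1 : ncmd := FOR vv DO IF NGet St $vv == 0 THEN vsel ::= $vv.

Definition ppick2 : ncmd :=
  FOR vv DO IF 1 <= NGet St $vv THEN IF NGet St $vv <= 2 THEN vsel ::= $vv.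

Definition pspread : ncmd :=
  FOR vv DO IF cadj $vsel $vv THEN IF NGet St $vv == 0 THEN
    NSet St $vv (3 - NGet St $vsel).

Definition pround : ncmd :=
  ppick1;; ppick2;; IF NGet St $vsel == 0 THEN NSet St $vsel 1;; pspread;;
  NSet St $vsel (2 + NGet St $vsel).

Definition pcolor : ncmd := FOR vi DO pround.

Definition pcount : ncmd :=
  FOR vv DO IF NGet St $vv == 3 THEN va ::= 1 + $va.

Definition pside : ncmd :=
  va ::= 0;; pcount;;
  NIf ($va + $va <= NGet Inp 0) (vsm ::= 3)
      (vsm ::= 4;; va ::= NGet Inp 0 - $va).

(** In an equitable colouring [n %% k] classes are large, of size [s + 1]. If these outnumber the
    [k - 8] unmixed classes, the 8 mixed ones are made large as well. At the end [vt] counts the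
    large unmixed classes. *)
Definition pquot : ncmd :=
  vs ::= NGet Inp 0 %/ $vk;; vt ::= NGet Inp 0 %% $vk;; vM ::= $vs;;
  IF $vk + 1 <= 8 + $vt THEN (vM ::= 1 + $vs;; vt ::= $vt - 8).

(** Large classes are cut from the smaller side first. If all [vt] of them fit, what remains is cut
    into classes of size [s]; otherwise only large classes are cut. The remainder [vr] goes to the
    mixed classes. *)
Definition psplit : ncmd :=
  NIf ($vt * (1 + $vs) <= $va)
    (vj ::= ($va - $vt) %/ $vs;; vr ::= ($va - $vt) %% $vs)
    (vj ::= $va %/ (1 + $vs);; vr ::= $va %% (1 + $vs)).

Definition pparam : ncmd := pquot;; psplit;; vl ::= $vk - 8 - $vj.

(* In the array [Cl], colour [c] is stored as [c + 1], and 0 stands for an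
   uncoloured vertex.  Colours 0 to 7 are the mixed ones, the next [l] are those
   of the rest of the larger side, the last [j] those of the smaller side. *)
Definition pAloop : ncmd :=
  FOR vv DO IF NGet St $vv == $vsm THEN (
    NIf (1 + $vidx <= $vr) (NSet Cl $vv (1 + $vidx %% 8))
      (NSet Cl $vv ($vk - ($vidx - $vr) %% $vj));;
    vidx ::= 1 + $vidx).

Definition pA : ncmd := vidx ::= 0;; pAloop.

Definition pmixcount (c : nat) : ncmd :=
  FOR vv DO IF NGet Cl $vv == c.+1 THEN vcnt ::= 1 + $vcnt.

Definition pmixtest (c : nat) : ncmd :=
  FOR vu DO IF NGet Cl $vu == c.+1 THEN IF cadj $vv $vu THEN vok ::= 0.

Definition pmixloop (c : nat) : ncmd :=
  FOR vv DO IF NGet Cl $vv == 0 THEN IF 1 + $vcnt <= $vM THEN (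
    vok ::= 1;; pmixtest c;;
    IF $vok THEN (NSet Cl $vv c.+1;; vcnt ::= 1 + $vcnt)).

Definition pmix (c : nat) : ncmd := vcnt ::= 0;; pmixcount c;; pmixloop c.

Definition pmixes (c m : nat) : ncmd :=
  foldr (fun c p => pmix c;; p) NSkip (iota c m).

Definition pBloop : ncmd :=
  FOR vv DO IF NGet Cl $vv == 0 THEN
    (NSet Cl $vv (9 + $vidx %% $vl);; vidx ::= 1 + $vidx).

Definition pB : ncmd := vidx ::= 0;; pBloop.

Definition pout : ncmd :=
  FOR vv DO NSet Inp (1 + $vv) (NGet Cl $vv - 1).

Definition prog : ncmd :=
  pdeg;; pcolor;; pside;; pparam;; pA;;
  pmixes 0 8;; pB;; pout.

End Programs.

Lemma wf_prog : wf prog. Proof. by []. Qed.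

Lemma depth_prog : depth prog = 2. Proof. by []. Qed.

Lemma writes_prog : ~~ writes prog Inp 0. Proof. by []. Qed.

(** * Maximum degree and number of colours *)

Section Degree.

Variable I : nat -> nat.
Let n := I 0.

Definition adj (u v : nat) : bool := I (1 + (u * I 0 + v)) != 0.

Lemma nev_cadj S e1 e2 : S Inp =1 I ->
  (nev S (cadj e1 e2) != 0) = adj (nev S e1) (nev S e2).
Proof. by move=> SI; rewrite /= !SI. Qed.

Lemma frame_Inp c S S' : frame c S S' -> S Inp =1 I ->
  (forall i, ~~ writes c Inp i) -> S' Inp =1 I.
Proof. by move=> fr SI w i; rewrite fr. Qed.

Lemma run_Inp c S : S Inp =1 I -> (forall i, ~~ writes c Inp i) ->
  run c S Inp =1 I.
Proof. by move=> SI w; exact: (frame_Inp (@run_frame c S) SI w). Qed.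

Lemma run_pdegree S : S Inp =1 I -> S Var vcnt = 0 ->
  run pdegree S Var vcnt = num (adj (S Var vu)) n.
Proof.
move=> SI S0; apply: (for_ind (n := n) (P := fun m T =>
  T Var vcnt = num (adj (S Var vu)) m)) => // m T _ Tm fr IH.
have TI := frame_Inp fr SI (fun=> isT).
rewrite runE nev_cadj //= Tm (fr Var vu) // numS.
by case: ifP => _; rewrite runE ?addn0 // /upd /= IH addnC.
Qed.

Lemma run_pdeg S : S Inp =1 I ->
  let D := \max_(0 <= u < n) num (adj u) n in
  run pdeg S Var vDelta = D /\ run pdeg S Var vk = 1 + (1 + D) %/ 2.
Proof.
move=> SI; rewrite /pdeg !runE; set S1 := upd S _ _ _.
have S1I : S1 Inp =1 I by [].
have : run pmaxdegree S1 Var vDelta = \max_(0 <= u < n) num (adj u) n.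
  apply: (for_ind (n := n) (P := fun i S' =>
    S' Var vDelta = \max_(0 <= u < i) num (adj u) n)) => //.
    by rewrite big_geq.
  move=> i S' _ S'i fr IH; have S'I := frame_Inp fr S1I (fun=> isT).
  rewrite !runE; set S2 := upd S' _ _ _.
  have := @run_pdegree S2 S'I (erefl 0); rewrite [S2 Var vu]S'i => cntE.
  rewrite big_nat_recr //= -IH -cntE.
  have -> : S' Var vDelta = run pdegree S2 Var vDelta by rewrite run_frame.
  by rewrite /=; case: leqP => h; rewrite /upd.
by rewrite /upd /= => ->.
Qed.

End Degree.

(** * Bipartition *)

(** The statuses in [f] agree with some 2-colouring [P], neighbours of finished vertices are
    coloured, and exactly [i] vertices are finished. [P] is existential because it may change from
    round to round. *)
Definition colinv (E : rel nat) (n i : nat) (f : nat -> nat) : Prop :=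
  exists P : nat -> bool,
  [/\ forall u v, u < n -> v < n -> E u v -> P u != P v,
      forall v, v < n -> [|| f v == 0, f v == 1 + P v | f v == 3 + P v],
      forall u v, u < n -> v < n -> 2 < f u -> E u v -> f v != 0
    & num (fun v => 2 < f v) n = i].

(** If the picked vertex is uncoloured, every coloured vertex is finished and so has only coloured
    neighbours. Hence no edge joins coloured and uncoloured vertices, and recolouring the latter
    keeps [P] a 2-colouring. *)
Lemma colinv_step (E : rel nat) n i (f f' : nat -> nat) p :
    (forall u v, u < n -> v < n -> E u v = E v u) -> p < n -> f p <= 2 ->
    (f p = 0 -> forall v, v < n -> f v = 0 \/ 2 < f v) ->
    let q := if f p == 0 then 1 else f p in
    (forall v, v < n -> f' v = if v == p then 2 + q
                               else if E p v && (f v == 0) then 3 - q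
                               else f v) ->
  colinv E n i f -> colinv E n i.+1 f'.
Proof.
move=> Esym pn fp2 fp0 q f'E [P [PE fP fE numf]].
have numf' : num (fun v => 2 < f' v) n = i.+1.
  rewrite -numf; apply: (num_upd1 pn); first by rewrite -leqNgt.
    by rewrite f'E // eqxx /q; case: eqP => //; lia.
  move=> v vn /negPf vp; rewrite f'E // vp; case: ifP => // /andP[_ /eqP->].
  by rewrite /q; case: eqP => //; lia.
(* The colours of an untouched component may be exchanged so that [p] gets 1. *)
have [P' [P'E fP' qP']] : exists P' : nat -> bool,
    [/\ forall u v, u < n -> v < n -> E u v -> P' u != P' v,
        forall v, v < n -> [|| f v == 0, f v == 1 + P' v | f v == 3 + P' v]
      & q = 1 + P' p].
  have [z|nz] := eqVneq (f p) 0; last first.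
    exists P; split=> //; rewrite /q (negPf nz).
    by have := fP p pn; case: (P p); lia.
  exists (fun v => if f v == 0 then P v (+) P p else P v); split.
  - move=> u v un vn uv; have := PE u v un vn uv.
    have [uz|unz] := eqVneq (f u) 0; have [vz|vnz] := eqVneq (f v) 0 => //.
    + by case: (P u); case: (P v); case: (P p).
    + case: (fp0 z v vn) => [|/(fE v u vn un)].
        by move/eqP; rewrite (negPf vnz).
      by rewrite Esym // uv uz => /(_ isT).
    + case: (fp0 z u un) => [|/(fE u v un vn)].
        by move/eqP; rewrite (negPf unz).
      by rewrite uv vz => /(_ isT).
  - by move=> v vn; have := fP v vn; case: eqP.
  - by rewrite /q z eqxx addbb.
exists P'; split=> // [v vn|u v un vn].
  rewrite f'E //; have [->|vp] := eqVneq v p; first by rewrite qP'; lia.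
  case: ifP => [/andP[pv _]|_]; last exact: fP'.
  by have := P'E p v pn vn pv; rewrite qP'; case: (P' p); case: (P' v).
move=> fu uv; rewrite f'E //; have [_|vp] := eqVneq v p; first by rewrite qP'.
case: ifP => [_|/negbT]; first by rewrite qP'; case: (P' p).
rewrite negb_and => /orP[npv|//].
have up : u != p by apply/eqP => e; rewrite -e uv in npv.
move: fu; rewrite f'E // (negPf up).
by case: ifP => [_|_ fu]; [rewrite qP'; lia|exact: (fE u v)].
Qed.

Section Coloring.

Variable I : nat -> nat.
Let n := I 0.

(** The second scan overrides the first, so an uncoloured vertex is picked only when no coloured one
    is unfinished. *)
Lemma run_pround S :
    S Inp =1 I -> (exists2 v, v < n & S St v <= 2) ->
    (forall v, v < n -> ~~ adj I v v) ->
  exists p, [/\ p < n, S St p <= 2,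
    S St p = 0 -> forall v, v < n -> S St v = 0 \/ 2 < S St v
  & let q := if S St p == 0 then 1 else S St p in
    forall v, v < n -> run pround S St v =
      if v == p then 2 + q else if adj I p v && (S St v == 0) then 3 - q
      else S St v].
Proof.
move=> SI [v0 v0n Sv0] irr; rewrite /pround !runE.
set S1 := run ppick1 S; set S2 := run ppick2 S1.
have S1I : S1 Inp =1 I := run_Inp (c := ppick1) SI (fun=> isT).
have S2I : S2 Inp =1 I := run_Inp (c := ppick2) S1I (fun=> isT).
have S1St v : S1 St v = S St v by rewrite [LHS]run_frame.
have S2St v : S2 St v = S St v by rewrite [LHS]run_frame.
have pick1 : forall v, v < n -> S St v = 0 ->
    S1 Var vsel < n /\ S St (S1 Var vsel) = 0.
  apply: (for_ind (n := n) (P := fun i T => forall v, v < i -> S St v = 0 ->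
    T Var vsel < n /\ S St (T Var vsel) = 0)) => //.
  move=> i T lin Ti fr IH v; rewrite !runE /= Ti (fr St) //.
  rewrite ltnS leq_eqVlt; have [z|nz] := eqVneq (S St i) 0.
    by rewrite /upd /=.
  by case/predU1P=> [->|/IH h]; [move/eqP; rewrite (negPf nz)|].
pose active v := 1 <= S St v <= 2.
have [pick2 pick20] : (forall v, v < n -> active v ->
      S2 Var vsel < n /\ active (S2 Var vsel)) /\
    ((forall v, v < n -> ~~ active v) -> S2 Var vsel = S1 Var vsel).
  apply: (for_ind (n := n) (P := fun i T =>
    (forall v, v < i -> active v -> T Var vsel < n /\ active (T Var vsel)) /\
    ((forall v, v < i -> ~~ active v) -> T Var vsel = S1 Var vsel))) => //.
  move=> i T lin Ti fr [IH IH0]; rewrite !runE /= Ti !(fr St) // S1St.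
  have -> : (if (0 < S St i) != 0 :> nat then
               if (S St i <= 2) != 0 :> nat then upd T Var vsel i else T
             else T) = if active i then upd T Var vsel i else T.
    by rewrite /active; case: (0 < _); case: (_ <= 2).
  case: ifP => Si; split.
  - by move=> v _ _; rewrite /upd /=.
  - by move=> /(_ i (ltnSn i)); rewrite Si.
  - move=> v; rewrite ltnS leq_eqVlt => /predU1P[->|]; first by rewrite Si.
    exact: IH.
  - by move=> h; apply: IH0 => v /ltnW; apply: h.
set p := S2 Var vsel.
have [pn Sp2 Sp0] : [/\ p < n, S St p <= 2
    & S St p = 0 -> forall v, v < n -> S St v = 0 \/ 2 < S St v].
  have [/existsP[v Sv]|/existsPn h] := boolP [exists v : 'I_n, active v].
    have [pn Sp] := pick2 v (ltn_ord v) Sv.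
    by split=> // [|z]; rewrite -/p /active in Sp *; lia.
  have h' v : v < n -> ~~ active v by move=> vn; apply: (h (Ordinal vn)).
  (* With no active vertex, the unfinished vertex [v0] is uncoloured, so the first scan has found an
     uncoloured vertex. *)
  have Sv00 : S St v0 = 0 by have := h' _ v0n; rewrite /active; lia.
  have [] := pick1 v0 v0n Sv00; rewrite -(pick20 h') -/p => pn Sp.
  split=> //; first by rewrite Sp.
  by move=> _ v /h'; rewrite /active; lia.
exists p; split=> // v vn; set q := (if S St p == 0 then 1 else S St p).
set S3 := (if _ then _ else _).
have S3I : S3 Inp =1 I by rewrite /S3; case: ifP.
have S3p : S3 Var vsel = p by rewrite /S3; case: ifP.
have S3St w : S3 St w = if w == p then q else S St w.
  rewrite /S3 /= -/p S2St /q.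
  have [z|nz] := eqVneq (S St p) 0; rewrite /upd /= -/p ?S2St.
    by case: eqP.
  by have [->|] := eqVneq w p.
set S4 := run pspread S3.
have S4p : S4 Var vsel = p by rewrite [LHS]run_frame.
(* The statuses after spreading. The status of [p] is reread in every iteration; as [p] is excluded
   here, the value read is always [q]. *)
pose new w := if (w != p) && adj I p w && (S St w == 0) then 3 - q else S3 St w.
have [S4St _] : (forall w, w < n -> S4 St w = new w) /\
    forall w, n <= w -> S4 St w = S3 St w.
  apply: (for_ind (n := n) (P := fun i T =>
    (forall w, w < i -> T St w = new w) /\
    forall w, i <= w -> T St w = S3 St w)) => //.
  move=> i T lin Ti fr [IH IH0].
  have TI := frame_Inp fr S3I (fun=> isT).
  have Tp : T Var vsel = p by rewrite fr.
  have TStp : T St p = q.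
    case: (ltnP p i) => pi; first by rewrite IH // /new eqxx /= S3St eqxx.
    by rewrite IH0 // S3St eqxx.
  rewrite !runE (nev_cadj _ _ TI) /= Tp Ti TStp IH0 // S3St.
  have -> : (if adj I p i then
      if ((if i == p then q else S St i) == 0) != 0 :> nat
      then upd T St i (3 - q) else T else T) =
    if (i != p) && adj I p i && (S St i == 0) then upd T St i (3 - q) else T.
    have [->|ip] := eqVneq i p; first by rewrite (negPf (irr p pn)).
    by case: (adj I p i); case: (S St i == 0).
  split=> w.
    rewrite ltnS leq_eqVlt => /predU1P[->|wi].
      rewrite /new; case: ifP => _; first by rewrite /upd /= eqxx.
      by rewrite IH0.
    by rewrite -IH //; case: (_ && _) => //; rewrite /upd /= ltn_eqF.
  move=> iw; rewrite -IH0 1?ltnW //.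
  by case: (_ && _) => //; rewrite /upd /= gtn_eqF.
rewrite /upd /= S4p; have [_|vp] := eqVneq v p.
  by rewrite S4St // /new eqxx /= S3St eqxx.
by rewrite S4St // /new vp /= S3St (negPf vp).
Qed.

End Coloring.

Section Sides.

Variable I : nat -> nat.
Let n := I 0.

(** The given bipartition [P0] is the first witness of the invariant. Each round finishes one
    vertex, so after [n] rounds all statuses are 3 or 4. *)
Lemma run_pcolor S P0 :
    S Inp =1 I -> (forall v, v < n -> S St v = 0) ->
    (forall u v, u < n -> v < n -> adj I u v = adj I v u) ->
    (forall u v, u < n -> v < n -> adj I u v -> P0 u != P0 v :> bool) ->
  exists P : nat -> bool,
    (forall u v, u < n -> v < n -> adj I u v -> P u != P v) /\
    forall v, v < n -> run pcolor S St v = 3 + P v.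
Proof.
move=> SI St0 sym P0E.
have irr v : v < n -> ~~ adj I v v.
  by move=> vn; apply/negP => /(P0E v v vn vn); rewrite eqxx.
have [P [PE fP _ /num_full f3]] : colinv (adj I) n n (run pcolor S St).
  apply: (for_ind (n := n) (P := fun i T => colinv (adj I) n i (T St))) => //.
    exists P0; split=> // [v vn|u v un vn|]; rewrite ?St0 //.
    by rewrite num0 // => v vn; rewrite /= St0.
  move=> i T lin _ fr inv; have TI := frame_Inp fr SI (fun=> isT).
  (* Only [i < n] vertices are finished, so some vertex is left to pick. *)
  have [|p [pn Tp Tp0 TE]] := run_pround TI _ irr.
    case: (inv) => P [_ _ _ numT].
    have [|v vn nv] := @num_ltn (fun v => 2 < T St v) n; first by rewrite numT.
    by exists v => //; rewrite leqNgt.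
  exact: colinv_step TE inv.
by exists P; split=> // v vn; have := fP v vn; have := f3 v vn; lia.
Qed.

Lemma run_pside S :
    S Inp 0 = n -> (forall v, v < n -> 3 <= S St v <= 4) ->
  exists m, [/\ 3 <= m <= 4, run pside S Var vsm = m,
    run pside S Var va = num (fun v => S St v == m) n
  & 2 * run pside S Var va <= n].
Proof.
move=> Sn S34; rewrite /pside !runE; set S1 := upd S _ _ _.
set S2 := run pcount S1.
have S2a : S2 Var va = num (fun v => S St v == 3) n.
  apply: (for_ind (n := n) (P := fun i T =>
    T Var va = num (fun v => S St v == 3) i)) => // i T lin Ti fr IH.
  rewrite !runE /= Ti (fr St) // numS -[S1 St i]/(S St i).
  by case: (S St i == 3); rewrite /upd /= IH; lia.
have S2n : S2 Inp 0 = n by rewrite [LHS]run_frame.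
have num4 : num (fun v => S St v == 4) n = n - num (fun v => S St v == 3) n.
  rewrite -[n in n - _](size_iota 0) -(count_predC (fun v => S St v == 3)).
  rewrite addKn.
  by apply: eq_num => v vn; have := S34 v vn; rewrite /=; lia.
have [h|h] := boolP (S2 Var va + S2 Var va <= n).
  by exists 3; rewrite /= S2n h /upd /= S2a; split=> //; lia.
by exists 4; rewrite /= S2n (negPf h) /upd /= S2n num4 -S2a; split=> //; lia.
Qed.

End Sides.

(** * Arithmetic of the class sizes *)

(** The mixed classes have size [M] and take [r] vertices of the smaller side; the other [a - r]
    fill [j] classes. The larger side then keeps [B = (n - a) - (8 * M - r)] vertices, written
    without subtraction, for [l] classes. *)
Definition equipartition (n k a M j r l s : nat) : Prop :=
  [/\ r <= s, r <= a & s <= M <= s.+1] /\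
  [/\ k = 8 + l + j, 0 < l, j * s <= a - r <= j * s.+1
    & exists2 B, n + r = a + 8 * M + B & l * s <= B <= l * s.+1].

Lemma equipartitionP n k a M t j r :
    16 < k -> 40 <= n %/ k -> 2 * a <= n ->
    let s := n %/ k in
    M = (if k + 1 <= 8 + n %% k then s.+1 else s) ->
    t = (if k + 1 <= 8 + n %% k then n %% k - 8 else n %% k) ->
    j = (if t * s.+1 <= a then (a - t) %/ s else a %/ s.+1) ->
    r = (if t * s.+1 <= a then (a - t) %% s else a %% s.+1) ->
  equipartition n k a M j r (k - 8 - j) s.
Proof.
move=> k16 s40 an s ME tE jE rE.
have nE := divn_eq n k; rewrite -/s in nE s40.
have tk : n %% k < k by rewrite ltn_mod; lia.
(* The sizes add up: [t] of the [k - 8] unmixed classes are large. *)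
have nk : n = (k - 8) * s + t + 8 * M /\ t <= k - 8.
  have ks : k * s = (k - 8) * s + 8 * s by rewrite -mulnDl; congr (_ * _); lia.
  move: ME tE; case: ifP => h -> ->; last by split; lia.
  by rewrite mulnS; split; lia.
(* Of the [t] large unmixed classes, [minn t j] lie in the smaller side. *)
have [jsa rs ra aE] :
    [/\ j * s <= a - r <= j * s.+1, r <= s, r <= a & a - r = j * s + minn t j].
  move: jE rE; case: leqP => h -> ->.
    have := divn_eq (a - t) s; set q := _ %/ _; set x := _ %% _ => e.
    have xs : x < s by rewrite ltn_mod; lia.
    have tq : t <= q by rewrite leq_divRL; [move: h; rewrite mulnS; lia|lia].
    have ta : t <= a by move: h; rewrite mulnS; lia.
    by rewrite mulnS (minn_idPl tq); split; lia.
  have := divn_eq a s.+1; set q := _ %/ _; set x := _ %% _ => e.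
  have xs : x < s.+1 by rewrite ltn_mod.
  have qt : q < t by rewrite ltn_divLR.
  by rewrite (minn_idPr (ltnW qt)); move: e; rewrite !mulnS; split; lia.
(* Some class is left for the larger side: [2 * j * s <= n], while [n] is below [2 * (k - 8) * s]
   because [k - 8 >= 9] and [s >= 40]. *)
have jk : j + 8 < k.
  suff : 2 * (j * s) < 2 * ((k - 8) * s) by rewrite !ltn_mul2l ltn_mul2r; lia.
  have : 2 * (j * s) <= n by lia.
  have : 8 * M <= 8 * s.+1 by rewrite ME; case: ifP; lia.
  have h9 : 9 * (s - 1) <= (k - 8) * (s - 1) by rewrite leq_mul2r; lia.
  have ks : (k - 8) * s = (k - 8) * (s - 1) + (k - 8).
    by rewrite -mulnSr; congr (_ * _); lia.
  by lia.
case: nk => nk tk8.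
split; first by split=> //; rewrite ME; case: ifP; lia.
split=> //; [lia|lia|].
(* The larger side receives the large classes that the smaller side did not use. *)
exists ((k - 8 - j) * s + (t - minn t j)); last by rewrite mulnS; lia.
have yE : (k - 8) * s = j * s + (k - 8 - j) * s.
  by rewrite -mulnDl; congr (_ * _); lia.
lia.
Qed.

Lemma run_pquot S n k : S Inp 0 = n -> S Var vk = k ->
  let b := k + 1 <= 8 + n %% k in
  [/\ run pquot S Var vs = n %/ k,
      run pquot S Var vt = (if b then n %% k - 8 else n %% k)
    & run pquot S Var vM = (if b then (n %/ k).+1 else n %/ k)].
Proof.
move=> Sn Sk b; rewrite /pquot !runE /= /upd /= Sn Sk /= -/b.
by case: b.
Qed.

Lemma run_psplit S s t a : S Var vs = s -> S Var vt = t -> S Var va = a ->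
  let b := t * s.+1 <= a in
  run psplit S Var vj = (if b then (a - t) %/ s else a %/ s.+1) /\
  run psplit S Var vr = (if b then (a - t) %% s else a %% s.+1).
Proof.
move=> Ss St Sa b; rewrite /psplit !runE /= Ss St Sa add1n -/b.
by case: b; rewrite /upd /= Ss ?St Sa.
Qed.

Lemma run_pparam S n k a :
    S Inp 0 = n -> S Var vk = k -> S Var va = a ->
    16 < k -> 40 <= n %/ k -> 2 * a <= n ->
  let T := run pparam S in
  equipartition n k a (T Var vM) (T Var vj) (T Var vr) (T Var vl) (n %/ k).
Proof.
move=> Sn Sk Sa k16 s40 an; rewrite /pparam 2!runSeq /=.
have [S1s S1t S1M] := run_pquot Sn Sk.
have := @run_frame pquot S.
move: (run pquot S) S1s S1t S1M => S1 S1s S1t S1M fr1.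
have S1a : S1 Var va = a by rewrite fr1.
have S1k : S1 Var vk = k by rewrite fr1.
have [S2j S2r] := run_psplit S1s S1t S1a.
have := @run_frame psplit S1; move: (run psplit S1) S2j S2r => S2 S2j S2r fr2.
have S2k : S2 Var vk = k by rewrite fr2.
rewrite runSet /upd /= S2k (fr2 Var vM) //.
exact: equipartitionP.
Qed.

(** * Mixed classes *)

(** The ranks of the elements of [P] are the numbers below [num P n], each taken once. *)
Lemma num_rank (P Q : pred nat) n :
  num (fun v => P v && Q (num P v)) n = num Q (num P n).
Proof.
elim: n => // n IH; rewrite !numS IH.
by case: (P n); rewrite ?addn0 ?addn1 ?numS.
Qed.

(** Dealing [N] objects cyclically to [l] classes gives class [y] exactly [N %/ l] objects, and one
    more if [y < N %% l]. *)
Lemma num_mod l s y N :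
  y < l -> l * s <= N <= l * s.+1 -> s <= num (fun i => i %% l == y) N <= s.+1.
Proof.
move=> yl; have l0 : 0 < l by lia.
have -> : num (fun i => i %% l == y) N = N %/ l + (y < N %% l).
  elim: N => [|N IH]; first by rewrite div0n mod0n.
  rewrite numS IH divnS // modnS; case: ifP => d.
    have : N %% l = l.-1.
      move: d; rewrite /dvdn -addn1 -modnDml; have := ltn_pmod N l0.
      have [->|ne] := eqVneq (N %% l) l.-1; first by [].
      by move=> lt; rewrite modn_small; lia.
    by move=> ->; lia.
  by lia.
move=> h; have := divn_eq N l; have := ltn_pmod N l0.
have a1 : s <= N %/ l by rewrite leq_divRL //; lia.
have a2 : N %/ l <= s.+1 by rewrite -(leq_pmul2r l0); have := leq_divM N l; lia.
move: (N %% l) (N %/ l) a1 a2 h => x q a1 a2 h xl e.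
case: (ltnP q s.+1) => qs; first by case: (y < x); lia.
(* In this extreme case [N = l * s.+1], so the remainder vanishes and no class gets an extra
   object. *)
have qE : q = s.+1 by lia.
rewrite e qE mulnC in h; lia.
Qed.

Lemma num_mod_le l y N : 0 < l -> num (fun i => i %% l == y) N <= N %/ l + 1.
Proof.
move=> l0; have [yl|ly] := ltnP y l; last first.
  rewrite num0 // => i _ /=.
  by have := ltn_pmod i l0; lia.
have := @num_mod l (N %/ l) y N yl.
have := divn_eq N l; have := ltn_pmod N l0; move=> h1 h2.
by rewrite mulnC leq_divM mulnC; lia.
Qed.

Lemma num_split (P Q : pred nat) n :
  num P n = num (fun v => P v && Q v) n + num (fun v => P v && ~~ Q v) n.
Proof.
by elim: n => // n IH; rewrite !numS IH; case: (P n); case: (Q n) => /=; lia.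
Qed.

Lemma num_classes (f : nat -> nat) n M c :
  (forall x, x < c -> num (fun v => f v == x.+1) n = M) ->
  num (fun v => 0 < f v <= c) n = c * M.
Proof.
elim: c => [|c IH] h.
  by rewrite num0 // => v _ /=; lia.
rewrite (num_split _ (fun v => f v <= c)) mulSn addnC -{1}(h c) //.
congr (_ + _).
  by apply: eq_num => v _; lia.
rewrite -IH => [|x xc]; last by rewrite h // ltnW.
by apply: eq_num => v _; lia.
Qed.

(** Union bound, adding the vertices of [X] one at a time: each contributes at most [D] new
    neighbours. *)
Lemma num_neighbours (E : rel nat) (X : pred nat) n D m :
    (forall u, u < n -> num (E u) n <= D) -> m <= n ->
  num (fun w => has (fun u => X u && E u w) (iota 0 m)) n <= num X m * D.
Proof.
move=> deg; elim: m => [|m IH] mn.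
  by rewrite (eq_num (Q := pred0)) ?/num ?count_pred0.
rewrite numS mulnDl.
have IHm := IH (ltnW mn).
rewrite (num_split _ (fun w => has (fun u => X u && E u w) (iota 0 m))).
rewrite leq_add //.
  by apply: leq_trans IHm; apply: leq_num => w _ /andP[].
case: (boolP (X m)) => Xm; last first.
  rewrite num0 // => w _.
  by rewrite -addn1 iotaD has_cat /= (negPf Xm) /= !orbF andbN.
rewrite mul1n (leq_trans _ (deg m mn)) //; apply: leq_num => w _.
by rewrite -addn1 iotaD has_cat /= Xm orbF /= => /andP[/orP[->|]].
Qed.

Section MixedClass.

Variable I : nat -> nat.
Let n := I 0.
Variables (A : pred nat) (CA : nat -> nat) (M D : nat).

Hypothesis sym : forall u v, u < n -> v < n -> adj I u v = adj I v u.
Hypothesis bip : forall u v, u < n -> v < n -> adj I u v -> A u != A v.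
Hypothesis deg : forall u, u < n -> num (adj I u) n <= D.

(** State once the first [c] mixed classes are complete. Since 0 means uncoloured, the last clause
    is properness on the coloured vertices. *)
Definition mixinv (c : nat) (f : nat -> nat) : Prop :=
  [/\ forall v, v < n -> A v -> f v = CA v,
      forall v, v < n -> ~~ A v -> f v <= c,
      forall x, x < c -> num (fun v => f v == x.+1) n = M
    & forall u v, u < n -> v < n -> adj I u v -> f u = f v -> f u = 0].

(** State while class [c] is being filled. The last clause records why a scanned vertex was refused:
    the class is full or contains a neighbour. Either reason persists, because the class only
    grows. *)
Definition fillinv (c i : nat) (f : nat -> nat) (cnt : nat) : Prop :=
  [/\ [/\ forall v, v < n -> A v -> f v = CA v,
      forall v, v < n -> ~~ A v -> f v <= c.+1,
      forall x, x < c -> num (fun v => f v == x.+1) n = M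
    & forall u v, u < n -> v < n -> adj I u v -> f u = f v -> f u = 0],
    cnt = num (fun v => f v == c.+1) n, cnt <= M
  & forall w, w < i -> f w = 0 ->
      cnt = M \/ exists u, [/\ u < n, f u = c.+1 & adj I w u]].

Lemma fillinv_skip c i f f' cnt :
    (forall v, f' v = f v) ->
    (f i = 0 -> cnt = M \/ exists u, [/\ u < n, f u = c.+1 & adj I i u]) ->
  fillinv c i f cnt -> fillinv c i.+1 f' cnt.
Proof.
move=> f'E h [[fA fB fM fP] cntE cntM stuck]; split=> //.
- split.
  + by move=> v vn; rewrite f'E; apply: fA.
  + by move=> v vn; rewrite f'E; apply: fB.
  + by move=> x xc; rewrite -(fM x xc); apply: eq_num => v; rewrite f'E.
  + by move=> u v un vn uv; rewrite !f'E; apply: fP.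
- by rewrite cntE; apply: eq_num => v; rewrite f'E.
move=> w; rewrite ltnS leq_eqVlt f'E => wi fw0.
have : cnt = M \/ exists u, [/\ u < n, f u = c.+1 & adj I w u].
  by case/predU1P: wi fw0 => [->|/stuck].
by case=> [|[u [un fu uw]]]; [left|right; exists u; rewrite f'E].
Qed.

Lemma fillinv_add c i f f' cnt :
    i < n -> f i = 0 -> cnt < M -> (forall v, v < n -> A v -> CA v != 0) ->
    (forall u, u < n -> f u = c.+1 -> ~~ adj I i u) ->
    (forall v, f' v = if v == i then c.+1 else f v) ->
  fillinv c i f cnt -> fillinv c i.+1 f' cnt.+1.
Proof.
move=> lin fi0 ltM CA0 free f'E [[fA fB fM fP] cntE _ done_].
(* Vertices of [A] were coloured beforehand, so the uncoloured [i] lies on the other side. *)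
have nAi : ~~ A i by apply/negP => Ai; have := CA0 i lin Ai; rewrite -fA // fi0.
split=> //; last first.
- move=> w; rewrite ltnS leq_eqVlt f'E.
  case/predU1P=> [->|wi]; first by rewrite eqxx.
  rewrite ltn_eqF // => /(done_ w wi) [|[u [un fu uw]]]; first by lia.
  by right; exists u; split=> //; rewrite f'E; case: ifP.
- rewrite cntE; apply/esym; apply: (num_upd1 lin); rewrite ?f'E ?fi0 ?eqxx //.
  by move=> v vn /negPf vi; rewrite f'E vi.
split.
- move=> v vn Av; rewrite f'E; case: eqP => [e|_]; last exact: fA.
  by rewrite e (negPf nAi) in Av.
- by move=> v vn Av; rewrite f'E; case: eqP => // _; apply: fB.
- move=> x xc; rewrite -(fM x xc); apply: eq_num => v vn; rewrite f'E.
  by have [->|] := eqVneq v i; rewrite ?fi0; lia.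
move=> u v un vn uv; rewrite !f'E.
have [eu|ui] := eqVneq u i; have [ev|vi] := eqVneq v i.
- by have := bip un vn uv; rewrite eu ev eqxx.
- by move=> e; have := free v vn (esym e); rewrite -eu uv.
- by move=> e; have := free u un e; rewrite -ev sym // uv.
- exact: fP.
Qed.

(* Were class [c] not full at the end, every vertex outside [A] would be in one
   of the classes up to [c] or adjacent to the part of class [c] in [A]. *)
Lemma fillinv_full c f cnt :
    c.+1 * M + num (fun v => A v && (CA v == c.+1)) n * D
      < num (fun v => ~~ A v) n ->
  fillinv c n f cnt -> mixinv c.+1 f.
Proof.
move=> big [[fA fB fM fP] cntE cntM stuck].
suff e : cnt = M.
  split=> // x; rewrite ltnS leq_eqVlt => /predU1P[->|]; last exact: fM.
  by rewrite -cntE.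
apply/eqP; case: eqP => // ne; exfalso.
have ltM : cnt < M by lia.
move: big; apply/negP; rewrite -leqNgt.
rewrite (num_split _ (fun v => 0 < f v <= c.+1)) leq_add //.
  rewrite (num_split _ (fun v => f v == c.+1)) mulSn leq_add //.
    rewrite (leq_trans _ (ltnW ltM)) // cntE; apply: leq_num => v _.
    by case/andP.
  rewrite -(num_classes fM); apply: leq_num => v _.
  by lia.
pose X v := A v && (CA v == c.+1).
apply: leq_trans (num_neighbours X deg (leqnn n)).
apply: leq_num => w wn /andP[nA fw].
have fw0 : f w = 0 by have := fB w wn nA; lia.
case: (stuck w wn fw0) => [e|[u [un fu uw]]]; first by rewrite e ltnn in ltM.
have Au : A u by have := bip wn un uw; rewrite (negPf nA); case: (A u).
apply/hasP; exists u; first by rewrite mem_iota.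
by rewrite /X Au -fA // fu eqxx sym.
Qed.

(** Before the scan, class [c] contains vertices of [A] only, at most [M] by [leM]. The hypothesis
    [big] then guarantees that the greedy scan fills the class. *)
Lemma run_pmix c S :
    S Inp =1 I -> S Var vM = M -> (forall v, v < n -> A v -> CA v != 0) ->
    num (fun v => A v && (CA v == c.+1)) n <= M ->
    c.+1 * M + num (fun v => A v && (CA v == c.+1)) n * D
      < num (fun v => ~~ A v) n ->
  mixinv c (S Cl) -> mixinv c.+1 (run (pmix c) S Cl).
Proof.
move=> SI SM CA0 leM big inv; rewrite /pmix !runE; set S1 := upd S _ _ _.
set S2 := run (pmixcount c) S1.
have S2I : S2 Inp =1 I := run_Inp (c := pmixcount c) (S := S1) SI (fun=> isT).
have S2M : S2 Var vM = M by rewrite [LHS]run_frame.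
have S2Cl v : S2 Cl v = S Cl v by rewrite [LHS]run_frame.
have S2c : S2 Var vcnt = num (fun v => S Cl v == c.+1) n.
  apply: (for_ind (n := n) (P := fun i T =>
    T Var vcnt = num (fun v => S Cl v == c.+1) i)) => //; first exact: SI.
  move=> i T lin Ti fr IH; rewrite !runE /= Ti (fr Cl) // numS.
  rewrite -[S1 Cl i]/(S Cl i).
  by case: (S Cl i == c.+1); rewrite /upd /= IH; lia.
apply: (@fillinv_full c _ (run (pmixloop c) S2 Var vcnt) big).
apply: (for_ind (n := n)
  (P := fun i T => fillinv c i (T Cl) (T Var vcnt))) => //.
  case: inv => fA fB fM fP; rewrite S2c; split=> //.
    split.
    - by move=> v vn; rewrite S2Cl; apply: fA.
    - by move=> v vn Av; rewrite S2Cl ltnW // ltnS fB.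
    - by move=> x xc; rewrite -(fM x xc); apply: eq_num => v; rewrite S2Cl.
    - by move=> u v un vn uv; rewrite !S2Cl; apply: fP.
    by apply: eq_num => v; rewrite S2Cl.
  apply: leq_trans leM; apply: leq_num => v vn /eqP e.
  have [Av|Av] := boolP (A v); first by rewrite -fA // e eqxx.
  by have := fB v vn Av; lia.
move=> i T lin Ti fr IH; have TI := frame_Inp fr S2I (fun=> isT).
rewrite !runE /= Ti (fr Var vM) // S2M.
have [Ti0|Tin] := eqVneq (T Cl i) 0; last first.
  by apply: fillinv_skip IH => // e; rewrite e in Tin.
have [lt|ge] := ltnP (T Var vcnt) M; last first.
  have le : T Var vcnt <= M by case: IH.
  by apply: fillinv_skip IH => // _; left; lia.
rewrite /=; set S3 := upd T _ _ _; set S4 := run (pmixtest c) S3.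
have S3I : S3 Inp =1 I by [].
have ok : S4 Var vok =
    ~~ has (fun u => (T Cl u == c.+1) && adj I i u) (iota 0 n) :> nat.
  apply: (for_ind (n := n) (P := fun m S' => S' Var vok =
    ~~ has (fun u => (T Cl u == c.+1) && adj I i u) (iota 0 m) :> nat)) => //.
  move=> m S' _ Sm fr' IH'; have S'I := frame_Inp fr' S3I (fun=> isT).
  rewrite -[m.+1]addn1 iotaD has_cat add0n !runE (nev_cadj _ _ S'I) /=.
  rewrite Sm (fr' Var vv) // (fr' Cl) //.
  rewrite -[S3 Var vv]/(T Var vv) Ti -[S3 Cl m]/(T Cl m).
  rewrite orbF.
  by case: (T Cl m == c.+1); case: (adj I i m); rewrite /= ?orbF ?orbT.
have S4Cl v : S4 Cl v = T Cl v by rewrite [LHS]run_frame.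
have S4c : S4 Var vcnt = T Var vcnt by rewrite [LHS]run_frame.
have S4v : S4 Var vv = i by rewrite [LHS]run_frame.
case: hasP ok => [[u uin /andP[/eqP fu uw]]|free] okE; rewrite okE /upd /=.
  rewrite mem_iota in uin.
  by rewrite S4c; apply: fillinv_skip IH => // _; right; exists u.
rewrite S4c add1n; apply: fillinv_add IH => //.
  move=> u un fu; apply/negP => uw; case: free.
  by exists u; rewrite ?mem_iota ?fu ?eqxx.
by move=> v; rewrite S4v S4Cl.
Qed.

End MixedClass.

(** * Loops colouring the smaller side and the rest of the larger one, and output *)

(** The variable [vidx] always holds the rank of the current vertex in the smaller side, so the
    cyclic dealing is expressed by ranks. *)
Lemma run_pA S n m k r j :
    S Inp 0 = n -> S Var vsm = m -> S Var vk = k -> S Var vr = r ->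
    S Var vj = j -> (forall v, v < n -> S Cl v = 0) ->
  let rank := num (fun v => S St v == m) in
  forall v, v < n -> run pA S Cl v =
    if S St v == m then
      if rank v < r then 1 + rank v %% 8 else k - (rank v - r) %% j
    else 0.
Proof.
move=> Sn Sm Sk Sr Sj SCl rank; rewrite /pA !runE; set S1 := upd S _ _ _.
pose CA v := if S St v == m then
      if rank v < r then 1 + rank v %% 8 else k - (rank v - r) %% j
    else 0.
suff [_ h] : run pAloop S1 Var vidx = rank n /\
    forall v, v < n -> run pAloop S1 Cl v = if v < n then CA v else 0.
  by move=> v vn; rewrite h // vn.
apply: (for_ind (n := n) (P := fun i T => T Var vidx = rank i /\
    forall v, v < n -> T Cl v = if v < i then CA v else 0)) => //.
move=> i T lin Ti fr [Tidx TCl].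
have step T' : T' Cl i = CA i -> (forall v, v != i -> T' Cl v = T Cl v) ->
    forall v, v < n -> T' Cl v = if v < i.+1 then CA v else 0.
  move=> e e' v vn; have [->|vi] := eqVneq v i; first by rewrite ltnSn.
  by rewrite e' // TCl // ltnS [v <= i]leq_eqVlt (negPf vi).
rewrite !runE /= Ti (fr St) // (fr Var vsm) // (fr Var vr) // (fr Var vk) //.
rewrite (fr Var vj) // Tidx.
rewrite -[S1 St i]/(S St i) -[S1 Var vsm]/(S Var vsm) Sm.
rewrite -[S1 Var vr]/(S Var vr) Sr -[S1 Var vk]/(S Var vk) Sk.
rewrite -[S1 Var vj]/(S Var vj) Sj.
have rankS : rank i.+1 = rank i + (S St i == m) by exact: numS.
rewrite rankS; case: (eqVneq (S St i) m) => [e|ne] /=; last first.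
  split; first by rewrite Tidx addn0.
  by apply: step => //; rewrite TCl // ltnn /CA (negPf ne).
have -> : (1 + rank i <= r) = (rank i < r) by [].
case: (boolP (rank i < r)) => h; rewrite /upd /= Tidx addnC; split=> //.
  apply: (step (upd T Cl i _)) => [|v /negPf vi]; rewrite /upd /= ?vi //.
  by rewrite eqxx /CA e eqxx h.
apply: (step (upd T Cl i _)) => [|v /negPf vi]; rewrite /upd /= ?vi //.
by rewrite eqxx /CA e eqxx (negPf h).
Qed.

Lemma run_pB S n l :
    S Inp 0 = n -> S Var vl = l ->
  let rank := num (fun v => S Cl v == 0) in
  forall v, v < n -> run pB S Cl v =
    if S Cl v == 0 then 9 + rank v %% l else S Cl v.
Proof.
move=> Sn Sl rank; rewrite /pB !runE; set S1 := upd S _ _ _.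
pose CB v := if S Cl v == 0 then 9 + rank v %% l else S Cl v.
suff [_ h] : run pBloop S1 Var vidx = rank n /\
    forall v, run pBloop S1 Cl v = if v < n then CB v else S Cl v.
  by move=> v vn; rewrite h vn.
apply: (for_ind (n := n) (P := fun i T => T Var vidx = rank i /\
    forall v, T Cl v = if v < i then CB v else S Cl v)) => //.
move=> i T lin Ti fr [Tidx TCl].
have step T' : T' Cl i = CB i -> (forall v, v != i -> T' Cl v = T Cl v) ->
    forall v, T' Cl v = if v < i.+1 then CB v else S Cl v.
  move=> e e' v; have [->|vi] := eqVneq v i; first by rewrite ltnSn.
  by rewrite e' // TCl // ltnS [v <= i]leq_eqVlt (negPf vi).
rewrite !runE /= Ti (fr Var vl) // Tidx -[S1 Var vl]/(S Var vl) Sl TCl ltnn.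
have rankS : rank i.+1 = rank i + (S Cl i == 0) by exact: numS.
rewrite rankS; case: (eqVneq (S Cl i) 0) => [e|ne] /=; last first.
  split; first by rewrite Tidx addn0.
  by apply: step => //; rewrite TCl ltnn /CB (negPf ne).
rewrite /upd /= Tidx addnC; split=> //.
apply: (step (upd T Cl i _)) => [|v /negPf vi]; rewrite /upd /= ?vi //.
by rewrite eqxx /CB e.
Qed.

Lemma run_pout S n : S Inp 0 = n ->
  forall v, v < n -> run pout S Inp v.+1 = S Cl v - 1.
Proof.
move=> Sn.
apply: (for_ind (n := n) (P := fun i T =>
  forall v, v < i -> T Inp v.+1 = S Cl v - 1)) => //.
move=> i T lin Ti fr IH v; rewrite !runE /= Ti (fr Cl) // /upd /= add1n eqSS.
rewrite ltnS leq_eqVlt.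
by have [->|_ /IH] := eqVneq v i.
Qed.

Section MixedClasses.

Variable I : nat -> nat.
Let n := I 0.
Variables (A : pred nat) (CA : nat -> nat) (M D : nat).

Hypothesis sym : forall u v, u < n -> v < n -> adj I u v = adj I v u.
Hypothesis bip : forall u v, u < n -> v < n -> adj I u v -> A u != A v.
Hypothesis deg : forall u, u < n -> num (adj I u) n <= D.
Hypothesis CA0 : forall v, v < n -> A v -> CA v != 0.

Lemma run_pmixes c m S :
    S Inp =1 I -> S Var vM = M ->
    (forall x, x < c + m -> num (fun v => A v && (CA v == x.+1)) n <= M) ->
    (forall x, x < c + m ->
       x.+1 * M + num (fun v => A v && (CA v == x.+1)) n * D
         < num (fun v => ~~ A v) n) ->
  mixinv I A CA M c (S Cl) ->
  mixinv I A CA M (c + m) (run (pmixes c m) S Cl).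
Proof.
elim: m c S => [|m IH] c S SI SM leM big inv; first by rewrite addn0.
rewrite -[pmixes _ _]/(NSeq (pmix c) (pmixes c.+1 m)) runSeq -addSnnS.
apply: IH; rewrite -?[run _ _ Var vM]SM ?addSnnS //.
- exact: (run_Inp (c := pmix c) SI (fun=> isT)).
- by rewrite run_frame.
- by apply: (run_pmix (D := D)) => //; [apply: leM|apply: big]; lia.
Qed.

End MixedClasses.

(** * Sizes of the classes *)

Lemma num_prefix (P : pred nat) r a : r <= a ->
  num (fun i => (i < r) && P i) a = num P r.
Proof.
move=> ra; rewrite -(subnKC ra); elim: (a - r) => [|b IH].
  by rewrite addn0; apply: eq_num => i ->.
by rewrite addnS numS IH ltnNge leq_addr addn0.
Qed.

Lemma num_suffix (P : pred nat) r a : r <= a ->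
  num (fun i => (r <= i) && P (i - r)) a = num P (a - r).
Proof.
move=> ra; rewrite -{1}(subnKC ra); elim: (a - r) => [|b IH].
  rewrite addn0 (eq_num (Q := pred0)) ?/num ?count_pred0 // => i ir.
  by rewrite leqNgt ir.
by rewrite addnS !numS IH leq_addr addKn.
Qed.

Lemma num_lt (P : pred nat) v n : v < n -> P v -> num P v < num P n.
Proof.
move=> vn Pv; rewrite -(subnKC vn); elim: (n - v.+1) => [|m IH].
  by rewrite addn0 numS Pv addn1.
by rewrite addnS numS (leq_trans IH) ?leq_addr.
Qed.

(** The content of [Cl] after [pB], when [f] is its content after the mixed classes. *)
Definition fill (l : nat) (f : nat -> nat) (v : nat) : nat :=
  if f v == 0 then 9 + num (fun w => f w == 0) v %% l else f v.

Section Final.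

Variable I : nat -> nat.
Let n := I 0.
Variables (A : pred nat) (k a M j r l s : nat).

Hypothesis bip : forall u v, u < n -> v < n -> adj I u v -> A u != A v.
Hypothesis equi : equipartition n k a M j r l s.
Hypothesis aE : num A n = a.

(** Stored colours of the smaller side: the first [r] vertices are dealt to the mixed classes 1 to
    8, the others to the last [j] values, down from [k]. *)
Definition colA (v : nat) : nat :=
  if num A v < r then 1 + num A v %% 8 else k - (num A v - r) %% j.

Lemma colA_range v : v < n -> A v ->
  if num A v < r then 0 < colA v <= 8 else 8 + l < colA v <= k.
Proof.
move=> vn Av; have va := num_lt vn Av; rewrite aE in va.
case: equi => _ [kE l0 js _]; rewrite /colA; case: ltnP => h.
  by have := @ltn_pmod (num A v) 8 isT; lia.
(* A vertex of rank at least [r] exists, so [a - r > 0] and [j] is not 0; the reduction modulo [j]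
   is genuine. *)
have j0 : 0 < j by case: (j) js => //; lia.
by have := ltn_pmod (num A v - r) j0; lia.
Qed.

Lemma colA_neq0 v : v < n -> A v -> colA v != 0.
Proof. by move=> vn /(colA_range vn); case: ifP; lia. Qed.

Lemma num_colA_mixed x : x < 8 ->
  num (fun v => A v && (colA v == x.+1)) n <= r %/ 8 + 1.
Proof.
move=> x8; case: (equi) => -[_ ra _] _.
have <- : num (fun v => A v && ((num A v < r) && (num A v %% 8 == x))) n
          = num (fun v => A v && (colA v == x.+1)) n.
  apply: eq_num => v vn; case: (boolP (A v)) => //= Av.
  by have := colA_range vn Av; rewrite /colA; case: ltnP => //= h; lia.
rewrite (num_rank A (fun i => (i < r) && (i %% 8 == x))) aE num_prefix //.
exact: num_mod_le.
Qed.

Lemma num_colA_pure y : y < j ->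
  s <= num (fun v => A v && (colA v == k - y)) n <= s.+1.
Proof.
move=> yj; case: (equi) => -[_ ra _] [kE _ js _].
have <- : num (fun v => A v && ((r <= num A v) && ((num A v - r) %% j == y))) n
          = num (fun v => A v && (colA v == k - y)) n.
  apply: eq_num => v vn; case: (boolP (A v)) => //= Av.
  have := colA_range vn Av; rewrite /colA; case: leqP => //= h; last by lia.
  by have := @ltn_pmod (num A v - r) j; lia.
rewrite (num_rank A (fun i => (r <= i) && ((i - r) %% j == y))) aE
  (num_suffix (fun i => i %% j == y)) //.
exact: num_mod.
Qed.

Variable f : nat -> nat.
Hypothesis inv : mixinv I A colA M 8 f.

(** The coloured vertices are those of the 8 full mixed classes and the [a - r] vertices of [A]
    outside them. *)
Lemma num_uncolored B : n + r = a + 8 * M + B ->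
  num (fun v => f v == 0) n = B.
Proof.
case: inv => fA fB fM _ nE; case: equi => -[_ ra _] _.
have n8 := num_classes fM.
have n9 : num (fun v => 8 < f v) n = a - r.
  transitivity (num (fun i => (r <= i) && xpredT (i - r)) a).
    rewrite -aE -(num_rank A (fun i => (r <= i) && true)).
    apply: eq_num => v vn; case: (boolP (A v)) => Av /=; last first.
      by have := fB v vn Av; lia.
    have := colA_range vn Av; rewrite fA //.
    by case: ltnP; lia.
  by rewrite (num_suffix xpredT) // /num count_predT size_iota.
have := num_split xpredT (fun v => f v == 0) n.
rewrite /= (num_split (fun v => ~~ (f v == 0)) (fun v => f v <= 8)).
have -> : num (fun v => ~~ (f v == 0) && (f v <= 8)) n =
          num (fun v => 0 < f v <= 8) n by apply: eq_num => v _; lia.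
have -> : num (fun v => ~~ (f v == 0) && ~~ (f v <= 8)) n =
          num (fun v => 8 < f v) n by apply: eq_num => v _; lia.
by rewrite n8 n9 {1}/num count_predT size_iota; lia.
Qed.

Local Notation f' := (fill l f).

Lemma fill_range v : v < n -> [\/ f v = 0 /\ 8 < f' v <= 8 + l,
   0 < f v <= 8 /\ f' v = f v | [/\ A v, 8 + l < f v <= k & f' v = f v]].
Proof.
move=> vn; case: (equi) => _ [_ l0 _ _].
rewrite /fill; have [z|nz] := eqVneq (f v) 0.
  by constructor 1; have := ltn_pmod (num (fun v => f v == 0) v) l0; lia.
case: inv => fA fB _ _; case: (boolP (A v)) => Av; last first.
  by constructor 2; have := fB v vn Av; lia.
have := colA_range vn Av; rewrite fA //.
by case: ifP => _ h; [constructor 2|constructor 3].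
Qed.

(** Equal final colours lie in the same range of colours. In the mixed and the last range [fill]
    changes nothing and [f] is proper; the middle range contains no vertex of [A]. *)
Lemma fill_proper u v : u < n -> v < n -> adj I u v -> f' u != f' v.
Proof.
move=> un vn uv; case: inv => fA fB _ fP.
have Auv := bip un vn uv; apply/eqP => e.
have := fP u v un vn uv.
case: (fill_range un) => [[u0 h]|[h e1]|[Au h e1]];
  case: (fill_range vn) => [[v0 h']|[h' e2]|[Av h' e2]]; try lia.
- have nA w : w < n -> f w = 0 -> ~~ A w.
    move=> wn w0; apply/negP => Aw.
    by have := colA_neq0 wn Aw; rewrite -fA // w0.
  by rewrite (negPf (nA u un u0)) (negPf (nA v vn v0)) in Auv.
Qed.

Lemma fill_equitable x : x < k -> s <= num (fun v => f' v == x.+1) n <= s.+1.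
Proof.
move=> xk; case: (equi) => -[_ _ sM] [kE l0 _ [B nE lB]].
case: (inv) => fA fB fM _.
case: (ltnP x 8) => x8.
  rewrite (@eq_num _ (fun v => f v == x.+1)) ?fM // => v vn.
  by case: (fill_range vn) => [[v0 h]|[h e1]|[Au h e1]]; lia.
case: (ltnP x (8 + l)) => xl.
  rewrite (@eq_num _ (fun v =>
    (f v == 0) && (num (fun v => f v == 0) v %% l == x - 8))).
    rewrite (num_rank (fun v => f v == 0) (fun i => i %% l == x - 8)).
    by rewrite (num_uncolored nE) num_mod //; lia.
  move=> v vn; case: (fill_range vn) => [[v0 h]|[h e1]|[Au h e1]]; try lia.
  by rewrite /fill v0 eqxx /=; lia.
(* The last [j] colours are indexed downwards from [k], here by [k - x.+1 < j]. *)
have -> : x.+1 = k - (k - x.+1) by lia.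
rewrite (@eq_num _ (fun v => A v && (colA v == k - (k - x.+1)))).
  by apply: num_colA_pure; lia.
move=> v vn; case: (boolP (A v)) => Av /=; first rewrite -fA //.
by case: (fill_range vn) => [[v0 h]|[h e1]|[Au h e1]]; lia.
by case: (fill_range vn) => [[v0 h]|[h e1]|[Au h e1]]; lia.
Qed.

End Final.

(** * Correctness of the whole program *)

(** After multiplication by 8, the left side is at most [64 * (s + 1) + (s + 8) * D], the right side
    at least [4 * k * s >= 2 * (D + 2) * s]. The gap comes from [s * D] exceeding both [40 * D] and
    [1000 * s], up to equality. *)
Lemma room_for_mixed n k D a s r x X M :
    999 < D -> D + 2 <= 2 * k -> k * s <= n -> 2 * a <= n ->
    40 <= s -> r <= s -> s <= M <= s.+1 -> X <= r %/ 8 + 1 -> x < 8 ->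
  X <= M /\ x.+1 * M + X * D < n - a.
Proof.
move=> D1 Dk ks an s40 rs /andP[sM Ms] Xr x8.
have r8 := leq_divM r 8.
have XD : 8 * X * D <= (s + 8) * D by rewrite leq_mul2r; lia.
have Ds : (D + 2) * s <= 2 * k * s by rewrite leq_mul2r; lia.
have sD : 40 * D <= s * D by rewrite leq_mul2r; lia.
have sD' : s * 1000 <= s * D by rewrite leq_mul2l; lia.
have xM : x.+1 * M <= 8 * s.+1 by rewrite leq_mul.
have sD2 : (D + 2) * s = s * D + 2 * s by rewrite mulnDl mulnC.
have sD8 : (s + 8) * D = s * D + 8 * D by rewrite mulnDl.
have kS : 2 * k * s = 2 * (k * s) by rewrite mulnA.
have XD8 : 8 * X * D = 8 * (X * D) by rewrite mulnA.
by split; lia.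
Qed.

Lemma run_prog S I P0 :
    let n := I 0 in
    let D := \max_(0 <= u < n) num (adj I u) n in
    let k := uphalf D + 1 in
    S Inp =1 I -> (forall v, S St v = 0) -> (forall v, S Cl v = 0) ->
    (forall u v, u < n -> v < n -> adj I u v = adj I v u) ->
    (forall u v, u < n -> v < n -> adj I u v -> P0 u != P0 v :> bool) ->
    999 < D -> 41 * D <= 2 * n ->
  let f v := run prog S Inp v.+1 in
  [/\ forall v, v < n -> f v < k,
      forall u v, u < n -> v < n -> adj I u v -> f u != f v
    & exists s, forall x, x < k -> s <= num (fun v => f v == x) n <= s.+1].
Proof.
move=> n D k SI St0 Cl0 sym P0E D1 Dn f.
(* Intermediate states are abstracted to names with their frame property, so that the program text
   is not unfolded. *)
have name c T : exists T', T' = run c T /\ frame c T T'.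
  by exists (run c T); split=> //; apply: run_frame.
have keepI c T T' : frame c T T' -> (forall i, ~~ writes c Inp i) ->
    T Inp =1 I -> T' Inp =1 I.
  by move=> fr w TI; apply: frame_Inp fr TI w.
have [S1 [S1E fr1]] := name pdeg S.
have [S2 [S2E fr2]] := name pcolor S1.
have [S3 [S3E fr3]] := name pside S2.
have [S4 [S4E fr4]] := name pparam S3.
have [S5 [S5E fr5]] := name pA S4.
have [S6 [S6E fr6]] := name (pmixes 0 8) S5.
have [S7 [S7E fr7]] := name pB S6.
have fE' v : f v = run pout S7 Inp v.+1.
  rewrite /f /prog 7!runSeq; congr (run _ _ _ _).
  by rewrite S7E S6E S5E S4E S3E S2E S1E.
have S1I := keepI _ _ _ fr1 (fun=> isT) SI.
have S2I := keepI _ _ _ fr2 (fun=> isT) S1I.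
have S3I := keepI _ _ _ fr3 (fun=> isT) S2I.
have S4I := keepI _ _ _ fr4 (fun=> isT) S3I.
have S5I := keepI _ _ _ fr5 (fun=> isT) S4I.
have S6I := keepI _ _ _ fr6 (fun=> isT) S5I.
have S7I := keepI _ _ _ fr7 (fun=> isT) S6I.
have S1k : S1 Var vk = k.
  by have [_ /=] := run_pdeg SI; rewrite -S1E => ->; rewrite divn2 addnC.
have [P [PE S2St]] : exists P : nat -> bool,
    (forall u v, u < n -> v < n -> adj I u v -> P u != P v) /\
    forall v, v < n -> S2 St v = 3 + P v.
  by rewrite S2E; apply: run_pcolor sym P0E => // v _; rewrite fr1.
have S2St34 v : v < n -> 3 <= S2 St v <= 4 by move=> /S2St ->; case: (P v).
have [m [m34 S3m S3a S3an]] := run_pside (S2I 0) S2St34.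
rewrite -S3E -/n in S3m S3a S3an.
pose A v := S2 St v == m; set a := S3 Var va in S3a S3an.
have bip u v : u < n -> v < n -> adj I u v -> A u != A v.
  move=> un vn uv; have := PE u v un vn uv; rewrite /A !S2St //.
  by case: (P u); case: (P v); lia.
have S3k : S3 Var vk = k by rewrite fr3 // fr2.
have k2 : 2 * k <= D + 3 <= 2 * k + 1 by rewrite /k uphalf_half; lia.
have k16 : 16 < k by lia.
(* Here the ratio 41/2 enters: [40 * k <= 20 * D + 60], which is at most [41 * D / 2 <= n] for large
   [D]. *)
have s40 : 40 <= n %/ k by rewrite leq_divRL; lia.
have equi := run_pparam (S3I 0) S3k (erefl a) k16 s40 S3an.
rewrite -S4E /= -/n in equi.
set s := n %/ k in s40 equi; set M := S4 Var vM in equi.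
set j := S4 Var vj in equi; set r := S4 Var vr in equi.
set l := S4 Var vl in equi.
have S4m : S4 Var vsm = m by rewrite fr4.
have S4k : S4 Var vk = k by rewrite fr4.
have S4St v : S4 St v = S2 St v by rewrite fr4 // fr3.
have S4Cl v : v < n -> S4 Cl v = 0 by rewrite fr4 // fr3 // fr2 // fr1.
have S5Cl v : v < n -> S5 Cl v = if A v then colA A k j r v else 0.
  move=> vn; rewrite S5E (run_pA (S4I 0) S4m S4k (erefl r) (erefl j) S4Cl vn).
  rewrite S4St /colA -/(A v).
  have -> // : num (fun w => S4 St w == m) v = num A v.
  by apply: eq_num => w _; rewrite S4St.
have S5M : S5 Var vM = M by rewrite fr5.
have deg u : u < n -> num (adj I u) n <= D.
  by move=> un; rewrite /D big_mkord (leq_bigmax (Ordinal un)).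
have numA : num A n = a by rewrite S3a.
have numAC : num (fun v => ~~ A v) n = n - a.
  have := num_split xpredT A n; rewrite /= numA.
  by rewrite {1}/num count_predT size_iota; lia.
have [[rs ra sM] [kE _ _ _]] := equi.
have room x : x < 8 ->
    let X := num (fun v => A v && (colA A k j r v == x.+1)) n in
    X <= M /\ x.+1 * M + X * D < num (fun v => ~~ A v) n.
  move=> x8 X; rewrite numAC.
  apply: (@room_for_mixed n k D a s r x X M) => //; first by lia.
  - by rewrite mulnC leq_divM.
  - exact: (num_colA_mixed equi numA).
(* Initially the smaller side has its colours and the other side is uncoloured, which is the
   invariant for [c = 0]. *)
have inv : mixinv I A (colA A k j r) M 8 (S6 Cl).
  rewrite S6E.
  apply: (@run_pmixes I A (colA A k j r) M D sym bip deg _ 0 8 S5) => //.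
  - by move=> v vn Av; apply: (colA_neq0 equi numA).
  - by move=> x /room [].
  - by move=> x /room [].
  split=> //.
  - by move=> v vn Av; rewrite S5Cl // Av.
  - by move=> v vn /negPf nA; rewrite S5Cl // nA.
  move=> u v un vn uv; rewrite !S5Cl //; have := bip u v un vn uv.
  by case: (boolP (A u)) => Au; case: (boolP (A v)) => Av.
have S6l : S6 Var vl = l by rewrite fr6 // fr5.
have S7Cl v : v < n -> S7 Cl v = fill l (S6 Cl) v.
  by move=> vn; rewrite S7E (run_pB (S6I 0) S6l vn).
have fE v : v < n -> f v = S7 Cl v - 1.
  by move=> vn; rewrite fE'; apply: run_pout vn; apply: S7I.
have S7pos v : v < n -> 0 < S7 Cl v <= k.
  move=> vn; rewrite S7Cl //.
  by case: (fill_range equi numA inv vn) => [[v0 h]|[h e1]|[Au h e1]]; lia.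
split.
- by move=> v vn; rewrite fE //; have := S7pos v vn; lia.
- move=> u v un vn uv; have := fill_proper bip equi numA inv un vn uv.
  rewrite -S7Cl // -S7Cl // !fE //; have := S7pos v vn; have := S7pos u un.
  lia.
exists s => x xk.
have := fill_equitable equi numA inv xk.
rewrite (eq_num (Q := fun v => f v == x)) // => v vn.
by rewrite -S7Cl // fE //; have := S7pos v vn; lia.
Qed.

(** * From the input array to graphs *)

Definition input_state n (G : sgraph 'I_n) : state := fun a i =>
  match a, i with
  | Inp, 0 => n
  | Inp, m.+1 => [exists i : 'I_n, exists j : 'I_n, (m == i * n + j) && G i j]
  | _, _ => 0
  end.

Lemma rep_input_state n (G : sgraph 'I_n) : rep (graph_input G) (input_state G).
Proof. by case=> // -[]. Qed.

(** Since [v < n], the index [u * n + v] determines [u] and [v] by Euclidean division. *)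
Lemma adj_input_state n (G : sgraph 'I_n) (u v : 'I_n) :
  adj (input_state G Inp) u v = G u v.
Proof.
rewrite /adj /=.
have -> : [exists i : 'I_n, exists j : 'I_n,
             (u * n + v == i * n + j) && G i j] = G u v.
  apply/existsP/idP => [[i /existsP[j /andP[/eqP e Gij]]]|Guv]; last first.
    by exists u; apply/existsP; exists v; rewrite eqxx.
  have n0 : 0 < n := leq_ltn_trans (leq0n u) (ltn_ord u).
  have eu : u = i.
    apply: val_inj; have := congr1 (divn^~ n) e.
    by rewrite /= !divnMDl // !divn_small // !addn0.
  have ev : v = j by apply: val_inj; move: e; rewrite eu => /addnI.
  by rewrite eu ev.
by case: (G u v).
Qed.

Lemma card_num n (P : pred nat) : #|[set v : 'I_n | P v]| = num P n.
Proof.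
rewrite cardE size_filter /num -val_enum_ord count_map enumT.
by apply: eq_count => v; rewrite /= inE.
Qed.

Lemma max_degree_input_state n (G : sgraph 'I_n) :
  \max_(0 <= u < n) num (adj (input_state G Inp) u) n = max_degree G.
Proof.
rewrite big_mkord; apply: eq_bigr => u _; rewrite -card_num.
by apply: eq_card => v; rewrite !inE adj_input_state.
Qed.

Lemma prog_correct n (G : sgraph 'I_n) :
    bipartite G -> 999 < max_degree G -> 41 * max_degree G <= 2 * n ->
  exists f : 'I_n -> 'I_(uphalf (max_degree G) + 1),
    (forall i : 'I_n, run prog (input_state G) Inp i.+1 = f i) /\
    equitable_coloring G f.
Proof.
move=> [P PE] D1 Dn; pose P0 v := v \in [seq val i | i <- enum P].
have sym u v : u < n -> v < n ->
    adj (input_state G Inp) u v = adj (input_state G Inp) v u.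
  move=> un vn; rewrite -[u]/(val (Ordinal un)) -[v]/(val (Ordinal vn)).
  by rewrite !adj_input_state edge_sym.
have P0E u v : u < n -> v < n -> adj (input_state G Inp) u v -> P0 u != P0 v.
  move=> un vn; rewrite -[u]/(val (Ordinal un)) -[v]/(val (Ordinal vn)).
  by rewrite adj_input_state /P0 !(mem_map val_inj) !mem_enum; apply: PE.
have := @run_prog (input_state G) (input_state G Inp) P0 (fun=> erefl)
  (fun=> erefl) (fun=> erefl) sym P0E.
rewrite max_degree_input_state.
move: (run prog _) => T /(_ D1 Dn) [fk fP [q fq]].
exists (fun i : 'I_n => Ordinal (fk i (ltn_ord i))); split=> //.
split=> [u v uv|x y].
  by rewrite -val_eqE /=; apply: fP; rewrite ?adj_input_state.
have cls (z : 'I_(uphalf (max_degree G) + 1)) :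
    q <= #|[set i : 'I_n | Ordinal (fk i (ltn_ord i)) == z]| <= q.+1.
  have := fq z (ltn_ord z); rewrite -card_num.
  by congr (_ <= _ <= _); apply: eq_card => i; rewrite !inE -val_eqE.
case/andP: (cls x) (cls y) => _ xq /andP[qy _].
by apply: leq_trans xq _; rewrite -addn1 leq_add2r.
Qed.

Theorem corollary3p1 (R : realType) (zeta : R)
    (hzeta : (41%:R / 2%:R < zeta)%R) :
  exists c : nat, 0 < c /\
  exists (p : cmd) (K d : nat),
  forall (n : nat) (G : sgraph 'I_n),
    bipartite G ->
    c <= max_degree G ->
    (zeta * (max_degree G)%:R <= n%:R)%R ->
    exists (t : nat) (s : memory) (f : 'I_n -> 'I_(uphalf (max_degree G) + 1)),
      [/\ exec (K * n ^ d) p (graph_input G) t s,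
          t <= K * n ^ 2,
          coloring_output s f
        & equitable_coloring G f].
Proof.
(* One threshold serves every [zeta], as only [41 * D <= 2 * n] is drawn from the ratio. *)
exists 1000; split=> //.
(* Loops are nested at most twice, so time and stored integers are both at most
   [(tm 1 prog + 1) * n ^ 2]. *)
exists (comp prog), (tm 1 prog + 1), 2 => n G bG D1 hn.
have Dn : 41 * max_degree G <= 2 * n.
  rewrite -(ler_nat R) !natrM -ler_pdivrMl ?ltr0n // mulrA [(_^-1 * _)%R]mulrC.
  by apply: le_trans hn; apply: ler_wpM2r; [apply: ler0n|apply: ltW].
have n0 : 0 < n by lia.
have [f [fE eqf]] := prog_correct bG D1 Dn.
have Sn : forall a i, input_state G a i <= n.
  by case=> // -[|i] //=; case: [exists _, _].
have [t [s [ex tle rs]]] :=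
  exec_comp_depth wf_prog writes_prog depth_prog n0 (rep_input_state G)
    erefl Sn.
exists t, s, f; split; [exact: ex|exact: tle| |exact: eqf].
by move=> i; rewrite -fE -rs.
Qed.
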